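(* Let $M$ be a closed Kähler manifold with an $r$-fold complex vector cross product ($\mathbb{C}$-VCP) for some $r\ge 1$. Then $M$ is either (i) a Calabi-Yau manifold, or (ii) a hyperkähler manifold.
   Context: ''Closed manifold'' means compact without boundary. Let $(M,g,J)$ be a Hermitian complex manifold of complex dimension $n$. An $r$-fold complex vector cross product ($\mathbb{C}$-VCP) on $M$ is a holomorphic form $\phi$ of degree $r+1$ (i.e. $\phi\in\Omega^{r+1,0}(M)$, $\bar\partial\phi=0$) such that $|\iota_{e_1\wedge\cdots\wedge e_r}\phi|=2^{(r+1)/2}$ for all $x\in M$ and all orthonormal $e_1,\dots,e_r\in T^{1,0}_xM$. Norms are the Hermitian extensions of the Riemannian ones, so that in unitary coordinates $z^j=x^j+\sqrt{-1}y^j$ at a point $|dz^j|=\sqrt2$, and $(a-\sqrt{-1}Ja)/\sqrt2\in T^{1,0}M$ has unit length when $a$ is a unit real tangent vector. A Calabi-Yau manifold of complex dimension $n$ is a Kähler manifold with a parallel complex (holomorphic) volume form, i.e. with holonomy group contained in $SU(n)$. A hyperkähler manifold is a Riemannian manifold of real dimension $4m$ with holonomy group contained in $Sp(m)=GL(m,\mathbb{H})\cap SO(4m)$, i.e. with parallel Hermitian complex structures $I,J,K$ satisfying $I^2=J^2=K^2=IJK=-\mathrm{Id}$.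
   Formalization: The formal theorem adds r ≤ n, n the complex dimension: for r > n there are no orthonormal r-frames in T^{1,0}M, the norm condition is vacuous, φ = 0 qualifies, and the claim fails (CP^1 with r = 2). *)

(* Defs.v *)
From HB Require Import structures.
From mathcomp Require Import all_boot all_order all_algebra complex.
From mathcomp Require Import all_classical all_reals all_analysis.

Set Implicit Arguments.
Unset Strict Implicit.
Unset Printing Implicit Defensive.

Import Order.TTheory GRing.Theory Num.Theory.
Import numFieldNormedType.Exports.

Local Open Scope classical_set_scope.
Local Open Scope ring_scope.

(* Conventions.  The coordinate space C^n is the real space 'cV[R]_(n + n) of
   columns (x, y) with z = x + iy, and multiplication by i is the matrix stdJ.
   Tangent vectors at a point are columns in the coordinate frame of a chart;
   vectors of the complexified tangent space are columns over R[i].  Tensor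
   fields are families of coordinate expressions, one for each chart of the
   atlas, related by the usual transformation rules.  The coordinate expression
   in the chart a is a function of the coordinate y, and is meaningful only for
   y in the image img A a of the chart. *)

Section Coordinates.
Variable R : realType.

Definition basis_vec d (j : 'I_d) : 'cV[R]_d := delta_mx j 0.

Definition iter_derive d (W : normedModType R) (s : seq 'cV[R]_d)
    (f : 'cV[R]_d -> W) : 'cV[R]_d -> W :=
  foldr (fun v h => 'D_v h) f s.

(* C^oo on the open set D *)
Definition smooth_on d (W : normedModType R) (D : set 'cV[R]_d)
    (f : 'cV[R]_d -> W) : Prop :=
  forall (s : seq 'cV[R]_d) (y : 'cV[R]_d),
    D y -> differentiable (iter_derive s f) y.

Definition Jac d (F : 'cV[R]_d -> 'cV[R]_d) (y : 'cV[R]_d) : 'M[R]_d :=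
  \matrix_(i, j) ('D_(basis_vec j) F y) i 0.

Definition stdJ n : 'M[R]_(n + n) := block_mx 0 (- 1%:M) 1%:M 0.

Definition holomorphic_map n (D : set 'cV[R]_(n + n))
    (F : 'cV[R]_(n + n) -> 'cV[R]_(n + n)) : Prop :=
  smooth_on D F /\
  forall y, D y -> Jac F y *m @stdJ n = @stdJ n *m Jac F y.

Definition cplx_mx m k (B : 'M[R]_(m, k)) : 'M[R[i]]_(m, k) :=
  map_mx (real_complex R) B.

Definition T10 n (v : 'cV[R[i]]_(n + n)) : Prop :=
  cplx_mx (@stdJ n) *m v = 'i%C *: v.

Definition T01 n (v : 'cV[R[i]]_(n + n)) : Prop :=
  cplx_mx (@stdJ n) *m v = - 'i%C *: v.

(* derivative of a complex-valued function along a real vector ... *)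
Definition derive_C d (f : 'cV[R]_d -> R[i]) (y w : 'cV[R]_d) : R[i] :=
  ('D_w (fun z => complex.Re (f z)) y +i* 'D_w (fun z => complex.Im (f z)) y)%C.

(* ... and along a complexified vector, by C-linear extension *)
Definition derive_CC d (f : 'cV[R]_d -> R[i]) (y : 'cV[R]_d)
    (w : 'cV[R[i]]_d) : R[i] :=
  derive_C f y (map_mx (@complex.Re R) w)
  + 'i%C * derive_C f y (map_mx (@complex.Im R) w).

(* Riemannian metric G and its Hermitian extension to complexified vectors and
   covectors (the latter given by the values al i on the coordinate frame) *)

Definition herm d (G : 'M[R]_d) (u v : 'cV[R[i]]_d) : R[i] :=
  (u^T *m cplx_mx G *m map_mx conjc v) 0 0.

Definition conorm d (G : 'M[R]_d) (al : 'I_d -> R[i]) : R :=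
  Num.sqrt (complex.Re
    (\sum_i \sum_j cplx_mx (invmx G) i j * al i * conjc (al j))).

(* Levi-Civita connection of the metric G : conn G y w is the matrix of
   v |-> Gamma(w, v), so that (nabla_w X)(y) = 'D_w X y + conn G y w *m X y *)

Definition christoffel d (G : 'cV[R]_d -> 'M[R]_d) (y : 'cV[R]_d)
    (k i j : 'I_d) : R :=
  2^-1 * \sum_l invmx (G y) k l *
    ('D_(basis_vec i) (fun z => G z j l) y
     + 'D_(basis_vec j) (fun z => G z i l) y
     - 'D_(basis_vec l) (fun z => G z i j) y).

Definition conn d (G : 'cV[R]_d -> 'M[R]_d) (y w : 'cV[R]_d) : 'M[R]_d :=
  \matrix_(k, j) \sum_i christoffel G y k i j * w i 0.

End Coordinates.

(* A complex atlas of complex dimension n on M.  The map inv_chart a is the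
   inverse of chart a; its values outside the image of dom a are irrelevant. *)
Record complex_atlas (R : realType) (n : nat) (M : topologicalType) :=
  ComplexAtlas {
  idx : Type;
  dom : idx -> set M;
  chart : idx -> M -> 'cV[R]_(n + n);
  inv_chart : idx -> 'cV[R]_(n + n) -> M;
  dom_open : forall a, open (dom a);
  dom_cover : forall p, exists a, dom a p;
  img_open : forall a, open (chart a @` dom a);
  chartK : forall a p, dom a p -> inv_chart a (chart a p) = p;
  chart_continuous : forall a p, dom a p -> {for p, continuous (chart a)};
  inv_chart_continuous : forall a y, (chart a @` dom a) y ->
    {for y, continuous (inv_chart a)};
  transition_holomorphic : forall a b,
    holomorphic_map (chart a @` (dom a `&` dom b)) (chart b \o inv_chart a)
}.

Section Manifold.
Variables (R : realType) (n : nat) (M : topologicalType).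
Variable A : complex_atlas R n M.

Local Notation d := (n + n)%N.
Local Notation V := 'cV[R]_d.
Local Notation VC := 'cV[R[i]]_d.

Definition img (a : idx A) : set V := chart a @` dom a.

(* differential at p of the coordinate change from the chart a to the chart b *)
Definition dtrans (a b : idx A) (p : M) : 'M[R]_d :=
  Jac (chart b \o inv_chart a) (chart a p).

Definition mx_field := idx A -> V -> 'M[R]_d.

Record hermitian_metric (g : mx_field) : Prop := HermitianMetric {
  metric_smooth : forall a, smooth_on (img a) (g a);
  metric_trans : forall a b p, dom a p -> dom b p ->
    g a (chart a p)
    = (dtrans a b p)^T *m g b (chart b p) *m dtrans a b p;
  metric_sym : forall a y, img a y -> (g a y)^T = g a y;
  metric_pos : forall a y, img a y ->
    forall v : V, v != 0 -> 0 < (v^T *m g a y *m v) 0 0;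
  metric_hermitian : forall a y, img a y ->
    (@stdJ R n)^T *m g a y *m @stdJ R n = g a y
}.

Definition kahler_form (g : mx_field) (a : idx A) (y u v : V) : R :=
  ((@stdJ R n *m u)^T *m g a y *m v) 0 0.

(* the second clause is d omega = 0, evaluated on constant fields *)
Definition kahler (g : mx_field) : Prop :=
  hermitian_metric g /\
  forall a y, img a y -> forall u v w : V,
    'D_u (fun z => kahler_form g a z v w) y
    + 'D_v (fun z => kahler_form g a z w u) y
    + 'D_w (fun z => kahler_form g a z u v) y = 0.

(* complex-valued k-forms, evaluated on complexified tangent vectors *)
Definition form_field (k : nat) := idx A -> V -> ('I_k -> VC) -> R[i].

(* smooth sections of Lambda^{k,0} *)
Record form_k0 (k : nat) (phi : form_field k) : Prop := FormK0 {
  form_linear : forall a y, img a y ->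
    forall (v : 'I_k -> VC) (i : 'I_k) (c : R[i]) (u w : VC),
      phi a y (dfwith v i (c *: u + w))
      = c * phi a y (dfwith v i u) + phi a y (dfwith v i w);
  form_alt : forall a y, img a y ->
    forall (v : 'I_k -> VC) (i j : 'I_k),
      i != j -> v i = v j -> phi a y v = 0;
  form_type : forall a y, img a y ->
    forall (v : 'I_k -> VC) (i : 'I_k), T01 (v i) -> phi a y v = 0;
  form_smooth : forall a (v : 'I_k -> VC),
    smooth_on (img a) (fun y => complex.Re (phi a y v) : R^o) /\
    smooth_on (img a) (fun y => complex.Im (phi a y v) : R^o);
  form_trans : forall a b p, dom a p -> dom b p -> forall v : 'I_k -> VC,
    phi a (chart a p) v
    = phi b (chart b p) (fun i => cplx_mx (dtrans a b p) *m v i)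
}.

(* delbar phi = 0 : since phi is of type (k,0), delbar phi is the (k,1)-part of
   d phi, whose coefficients in holomorphic coordinates are the derivatives
   along T^{0,1} of the coefficients of phi *)
Definition holomorphic_form (k : nat) (phi : form_field k) : Prop :=
  form_k0 phi /\
  forall a y, img a y -> forall (v : 'I_k -> VC) (w : VC), T01 w ->
    derive_CC (fun z => phi a z v) y w = 0.

(* the arguments e_0, ..., e_(r-1), w *)
Definition rcons_vec (r : nat) (e : 'I_r -> VC) (w : VC) (k : 'I_r.+1) : VC :=
  if unlift ord_max k is Some i then e i else w.

Definition cvcp (g : mx_field) (r : nat) (phi : form_field r.+1) : Prop :=
  holomorphic_form phi /\
  forall a y, img a y -> forall e : 'I_r -> VC,
    (forall i, T10 (e i)) ->
    (forall i j, herm (g a y) (e i) (e j) = (i == j)%:R) ->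
    conorm (g a y)
      (fun k => phi a y (rcons_vec e (cplx_mx (basis_vec R k))))
    = 2 `^ (r.+1%:R / 2).

Definition parallel_form (g : mx_field) (k : nat) (phi : form_field k) : Prop :=
  forall a y, img a y -> forall (w : V) (v : 'I_k -> VC),
    derive_C (fun z => phi a z v) y w
    - \sum_i phi a y (dfwith v i (cplx_mx (conn (g a) y w) *m v i)) = 0.

Definition calabi_yau (g : mx_field) : Prop :=
  kahler g /\
  exists Omega : form_field n,
    [/\ holomorphic_form Omega,
        forall a y, img a y -> exists v, Omega a y v != 0
      & parallel_form g Omega].

Definition nijenhuis (I : V -> 'M[R]_d) (y u v : V) : V :=
  'D_(I y *m u) I y *m v - 'D_(I y *m v) I y *m u
  + I y *m ('D_v I y *m u) - I y *m ('D_u I y *m v).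

(* complex structures on the real manifold underlying M; they need not be
   related to the one given by the atlas *)
Record complex_structure (I : mx_field) : Prop := ComplexStructure {
  cs_smooth : forall a, smooth_on (img a) (I a);
  cs_trans : forall a b p, dom a p -> dom b p ->
    dtrans a b p *m I a (chart a p) = I b (chart b p) *m dtrans a b p;
  cs_square : forall a y, img a y -> I a y *m I a y = - 1%:M;
  cs_integrable : forall a y, img a y ->
    forall u v : V, nijenhuis (I a) y u v = 0
}.

Definition hermitian_endo (g I : mx_field) : Prop :=
  forall a y, img a y -> (I a y)^T *m g a y *m I a y = g a y.

(* (nabla_w I) = 'D_w I + [Gamma_w, I] *)
Definition parallel_endo (g I : mx_field) : Prop :=
  forall a y, img a y -> forall w : V,
    'D_w (I a) y + conn (g a) y w *m I a y - I a y *m conn (g a) y w = 0.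

(* a property of the Riemannian manifold (M, g) *)
Definition hyperkahler (g : mx_field) : Prop :=
  (exists m : nat, d = (4 * m)%N) /\
  exists I J K : mx_field,
    [/\ [/\ complex_structure I, complex_structure J & complex_structure K],
        [/\ hermitian_endo g I, hermitian_endo g J & hermitian_endo g K],
        [/\ parallel_endo g I, parallel_endo g J & parallel_endo g K]
      & forall a y, img a y -> I a y *m J a y *m K a y = - 1%:M].

End Manifold.

(* Main.v *)
Require Import Defs.
From HB Require Import structures.
From mathcomp Require Import all_boot all_order all_algebra perm complex ring lra.
From mathcomp Require Import all_classical all_reals all_analysis.

Set Implicit Arguments.
Unset Strict Implicit.
Unset Printing Implicit Defensive.

Import Order.TTheory GRing.Theory Num.Theory.
Import numFieldNormedType.Exports.

Local Open Scope classical_set_scope.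
Local Open Scope ring_scope.

(** Let phi be the cross product, a holomorphic form of type (r+1,0) on a Kähler
    manifold of complex dimension n.  The theorem follows from a pointwise
    classification and from one principle: phi is, up to scale, a holomorphic
    isometry from r-vectors to covectors, so it intertwines the Chern connections
    of the two bundles; on a Kähler manifold these are induced by the Levi-Civita
    connection, and phi is parallel as soon as its contractions span the covectors.

    Pointwise, the norm of a (1,0)-covector is the Hermitian norm of its values on
    a unitary frame ([conorm_frame]).  Polarising the norm condition therefore shows
    that the contractions of phi with the distinct r-subsets of a unitary frame are
    orthogonal with equal nonzero norms.  In an n-dimensional space there is room
    for them only if r = 1 or r = n - 1: with all arguments but two frozen, the
    count is already impossible for four free members of the frame
    ([no_cross_product]).  The value r = n is excluded because phi then vanishes
    ([cross_degree_neq]).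

    If r = n - 1, then phi = f dz^1 ... dz^n ([form_top]), and the norm condition
    says that |f|^4 is a constant multiple of the real determinant of the metric
    ([top_norm]).  By Jacobi's formula and metric compatibility the logarithmic
    derivative of |f|^2 along w is the trace of the connection matrix.  This is the
    real part of the assertion that f solves the equation of a parallel section,
    and the Cauchy-Riemann equations add the imaginary part ([derive_coefficient],
    [top_parallel]).  So phi itself is a parallel volume form.

    If r = 1, let b be the real part of phi and X the endomorphism with
    g(X u, v) = b(u, v).  The norm condition makes X an isometry of square -1
    ([iso_polar], [Phi_iso]), and X anticommutes with the complex structure J because
    phi has type (2,0).  Holomorphy gives nabla_(J w) X = (nabla_w X) J.
    Differentiating X X = -1 along w and along J w, one finds that nabla_w X both
    anticommutes and commutes with X, so that it vanishes
    ([parallel_of_quaternionic]).  Hence J, X, J X are parallel, integrable because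
    the connection is torsion-free, and satisfy the quaternion relations; the real
    dimension is divisible by four because a nondegenerate complex skew matrix has
    even size ([quaternionic_even]).

    That J is parallel is derived from d omega = 0 by Koszul's formula ([Gam_J]). *)

(** * Directional derivatives and smoothness *)

Section Calculus.
Variables (R : realType) (d : nat).
Local Notation V := 'cV[R]_d.

(** Coordinate expressions are meaningful only on the image of a chart, so every
    identity is differentiated on an open set; this makes such identities enough
    for differentiability as well. *)
Lemma near_eq_differentiable (W : normedModType R) (f h : V -> W) (y : V) :
  {near y, f =1 h} -> differentiable f y -> differentiable h y.
Proof.
move=> fh df.
have fhy : f y = h y by exact: (nbhs_singleton fh).
have L : forall e : R, 0 < e -> \forall z \near (0 : V),
    `|(f \o shift y - (cst (f y) + 'd f y)) z| <= e * `|id z|.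
  exact: eqadd_some_oP (diff_locally df).
have E : h \o shift y = cst (h y) + 'd f y +o_ (0 : V) id.
  rewrite littleoE; first by rewrite addrC subrK.
  move=> e e0; have fh0 : \forall z \near (0 : V), f (z + y) = h (z + y).
    have fh' : \forall z \near y, f z = h z := fh.
    by move: fh'; rewrite (near_shift 0) /= subr0.
  apply: filterS2 fh0 (L e e0) => z /= E.
  by rewrite !fctE /= E fhy.
apply/diff_locallyP; rewrite (diff_unique _ E); last exact: diff_continuous.
by split=> //; exact: diff_continuous.
Qed.

Lemma derive_dir_sum (W : normedModType R) (f : V -> W) y w :
  differentiable f y -> 'D_w f y = \sum_i w i 0 *: 'D_(basis_vec R i) f y.
Proof.
move=> df; have -> : w = \sum_i w i 0 *: basis_vec R i.
  by rewrite [LHS]matrix_sum_delta; apply: eq_bigr => i _; rewrite big_ord1.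
rewrite deriveE// linear_sum; apply: eq_bigr => i _.
rewrite linearZ deriveE//; congr (_ *: _).
rewrite summxE (bigD1 i)//= !mxE !eqxx mulr1 big1 ?addr0// => j /negPf ji.
by rewrite !mxE eq_sym ji mulr0.
Qed.

Lemma differentiable_entry m k (F : V -> 'M[R]_(m, k)) y i j :
  differentiable F y -> differentiable (fun z => F z i j) y.
Proof.
move=> dF; rewrite -[fun z => _]/((fun N : 'M[R]_(m, k) => N i j) \o F).
by apply: differentiable_comp => //; exact: differentiable_coord.
Qed.

Lemma differentiable_bigsum (W : normedModType R) (I : Type) (s : seq I)
    (f : I -> V -> W) y :
  (forall i, differentiable (f i) y) ->
  differentiable (fun z => \sum_(i <- s) f i z) y.
Proof.
move=> df; elim: s => [|i s IH].
  by under eq_fun do rewrite big_nil; exact: differentiable_cst.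
by under eq_fun do rewrite big_cons; exact: (@differentiableD _ _ _ (f i)).
Qed.

Lemma differentiable_mx m k (F : V -> 'M[R]_(m, k)) y :
  (forall i j, differentiable (fun z => F z i j) y) -> differentiable F y.
Proof.
move=> dF.
have -> : F = fun z => \sum_i \sum_j F z i j *: delta_mx i j.
  by apply/funext => z; exact: matrix_sum_delta.
apply: differentiable_bigsum => i; apply: differentiable_bigsum => j.
by apply: (@differentiableZl _ _ _ (fun z => F z i j) (delta_mx i j)).
Qed.

Lemma derive_entry m k (F : V -> 'M[R]_(m, k)) y v i j :
  differentiable F y -> 'D_v F y i j = 'D_v (fun z => F z i j) y.
Proof. by move=> dF; rewrite derive_mx ?mxE//; exact: diff_derivable. Qed.

Lemma derive_bigsum (I : Type) (s : seq I) (f : I -> V -> R) y v :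
  (forall i, differentiable (f i) y) ->
  'D_v (fun z => \sum_(i <- s) f i z) y = \sum_(i <- s) 'D_v (f i) y.
Proof.
move=> df; elim: s => [|i s IH].
  by under eq_fun do rewrite big_nil; rewrite big_nil derive_cst.
under eq_fun do rewrite big_cons; rewrite big_cons -IH.
rewrite (@deriveD _ _ _ (f i))//; apply: diff_derivable => //.
exact: differentiable_bigsum.
Qed.

Lemma derive_mulr (f h : V -> R) y v : differentiable f y -> differentiable h y ->
  'D_v (fun z => f z * h z) y = 'D_v f y * h y + f y * 'D_v h y.
Proof.
move=> df dh; rewrite -[fun z => _]/(f * h) deriveM; try exact: diff_derivable.
by rewrite /GRing.scale/= addrC mulrC [X in _ + X]mulrC [X in _ + X]mulrC.
Qed.

Lemma differentiable_mulr (f h : V -> R) y : differentiable f y ->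
  differentiable h y -> differentiable (fun z => f z * h z) y.
Proof. by move=> df dh; exact: (@differentiableM _ _ f h). Qed.

Lemma differentiable_mulmx m k l (F : V -> 'M[R]_(m, k)) (G : V -> 'M[R]_(k, l)) y :
  differentiable F y -> differentiable G y -> differentiable (fun z => F z *m G z) y.
Proof.
move=> dF dG; apply: differentiable_mx => i j.
under eq_fun do rewrite mxE.
by apply: differentiable_bigsum => q; apply: differentiable_mulr; exact: differentiable_entry.
Qed.

Lemma derive_mulmx m k l (F : V -> 'M[R]_(m, k)) (G : V -> 'M[R]_(k, l)) y v :
  differentiable F y -> differentiable G y ->
  'D_v (fun z => F z *m G z) y = 'D_v F y *m G y + F y *m 'D_v G y.
Proof.
move=> dF dG; apply/matrixP => i j.
rewrite derive_entry; last exact: differentiable_mulmx.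
under eq_fun do rewrite mxE.
rewrite derive_bigsum => [|q]; last first.
  by apply: differentiable_mulr; exact: differentiable_entry.
rewrite !mxE -big_split/=; apply: eq_bigr => q _.
by rewrite derive_mulr ?derive_entry//; exact: differentiable_entry.
Qed.

Lemma derive_scalar (c : R) (f : V -> R) y v : differentiable f y ->
  'D_v (fun z => c * f z) y = c * 'D_v f y.
Proof.
move=> df; rewrite derive_mulr// derive_cst mul0r add0r//.
Qed.

Lemma derive_constmx m k l (C : 'M[R]_(m, k)) (G : V -> 'M[R]_(k, l)) y v :
  differentiable G y -> 'D_v (fun z => C *m G z) y = C *m 'D_v G y.
Proof.
move=> dG; rewrite (@derive_mulmx _ _ _ (fun=> C)) ?derive_cst ?mul0mx ?add0r//.
Qed.

Lemma derive_mxconst m k l (F : V -> 'M[R]_(m, k)) (C : 'M[R]_(k, l)) y v :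
  differentiable F y -> 'D_v (fun z => F z *m C) y = 'D_v F y *m C.
Proof.
move=> dF; rewrite (@derive_mulmx _ _ _ _ (fun=> C)) ?derive_cst ?mulmx0 ?addr0//.
Qed.

Lemma near_open (D : set V) (y : V) : open D -> D y -> \forall z \near y, D z.
Proof. by move=> oD Dy; exact: open_nbhs_nbhs. Qed.

Lemma derive_eq_on (W : normedModType R) (D : set V) (f h : V -> W) y v :
  open D -> (forall z, D z -> f z = h z) -> D y -> 'D_v f y = 'D_v h y.
Proof.
move=> oD fh Dy; apply: near_eq_derive.
by apply: filterS (near_open oD Dy) => z; exact: fh.
Qed.

(** Finite order of smoothness, with the innermost derivative peeled first: the
   form in which closure under algebraic operations follows by induction. *)
Fixpoint Ck (W : normedModType R) (k : nat) (D : set V) (f : V -> W) : Prop :=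
  (forall y, D y -> differentiable f y) /\
  (if k is k'.+1 then forall v, Ck k' D (fun y => 'D_v f y) else True).

Lemma smooth_on_derive (W : normedModType R) (D : set V) (f : V -> W) v :
  smooth_on D f -> smooth_on D (fun y => 'D_v f y).
Proof. by move=> sf s y Dy; have := sf (rcons s v) y Dy; rewrite /iter_derive foldr_rcons. Qed.

Lemma smooth_onP (W : normedModType R) (D : set V) (f : V -> W) :
  smooth_on D f <-> forall k, Ck k D f.
Proof.
split=> [sf k|].
  elim: k f sf => [|k IH] f sf /=; first by split=> // y Dy; exact: (sf [::]).
  split; first by move=> y; exact: (sf [::]).
  by move=> v; apply: IH; exact: smooth_on_derive.
move=> + s; elim/last_ind: s f => [|s v IH] f Cf y Dy; first exact: (Cf 0).1.
rewrite /iter_derive foldr_rcons; apply: IH => // k.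
exact: (Cf k.+1).2.
Qed.

Lemma CkW (W : normedModType R) k (D : set V) (f : V -> W) : Ck k.+1 D f -> Ck k D f.
Proof.
elim: k f => [|k IH] f [df Df]; first by [].
by split=> // v; apply: IH; exact: Df.
Qed.

Lemma Ck_diff (W : normedModType R) k (D : set V) (f : V -> W) y :
  Ck k D f -> D y -> differentiable f y.
Proof. by case: k => [|k] [+ _]; apply. Qed.

Section OnOpen.
Variables (D : set V) (oD : open D).

Lemma Ck_eq (W : normedModType R) k (f h : V -> W) :
  (forall y, D y -> f y = h y) -> Ck k D f -> Ck k D h.
Proof.
elim: k f h => [|k IH] f h fh [df Df]; split=> //.
- move=> y Dy; apply: near_eq_differentiable (df y Dy).
  by apply: filterS (near_open oD Dy) => z; exact: fh.
- move=> y Dy; apply: near_eq_differentiable (df y Dy).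
  by apply: filterS (near_open oD Dy) => z; exact: fh.
move=> v; apply: IH (Df v) => y Dy.
exact: derive_eq_on fh Dy.
Qed.

Lemma Ck_cst (W : normedModType R) k (c : W) : Ck k D (fun=> c).
Proof.
elim: k c => [|k IH] c /=; split=> // v.
by apply: Ck_eq (IH 0) => y _; rewrite derive_cst.
Qed.

Lemma Ck_sum (I : finType) k (f : I -> V -> R) :
  (forall i, Ck k D (f i)) -> Ck k D (fun z => \sum_i f i z).
Proof.
elim: k f => [|k IH] f Cf; split=> //.
- by move=> y Dy; apply: differentiable_bigsum => i; exact: (Cf i).1.
- by move=> y Dy; apply: differentiable_bigsum => i; exact: (Cf i).1.
move=> v; apply: (@Ck_eq _ _ (fun y => \sum_i 'D_v (f i) y)) => [y Dy|].
  by rewrite derive_bigsum// => i; exact: (Cf i).1.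
by apply: IH => i; exact: (Cf i).2.
Qed.

Lemma Ck_add k (f h : V -> R) : Ck k D f -> Ck k D h -> Ck k D (fun z => f z + h z).
Proof.
move=> Cf Ch; have := @Ck_sum bool k (fun b => if b then f else h).
by under eq_fun do rewrite big_bool/=; apply; case.
Qed.

Lemma Ck_mul k (f h : V -> R) : Ck k D f -> Ck k D h -> Ck k D (fun z => f z * h z).
Proof.
elim: k f h => [|k IH] f h Cf Ch; split=> //.
- by move=> y Dy; apply: differentiable_mulr; [exact: Cf.1 | exact: Ch.1].
- by move=> y Dy; apply: differentiable_mulr; [exact: Cf.1 | exact: Ch.1].
move=> v; apply: (@Ck_eq _ _ (fun y => 'D_v f y * h y + f y * 'D_v h y)) => [y Dy|].
  by rewrite derive_mulr//; [exact: Cf.1 | exact: Ch.1].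
apply: Ck_add; apply: IH; first exact: Cf.2; first exact: CkW.
  exact: CkW.
exact: Ch.2.
Qed.

Lemma Ck_prod (I : finType) k (f : I -> V -> R) :
  (forall i, Ck k D (f i)) -> Ck k D (fun z => \prod_i f i z).
Proof.
move=> Cf; elim: (index_enum I) => [|i s IH].
  by under eq_fun do rewrite big_nil; exact: Ck_cst.
by under eq_fun do rewrite big_cons; exact: Ck_mul.
Qed.

(** The derivative of the inverse of [f] is polynomial in that inverse and the
    derivative of [f], so the inverse gains one order at each step. *)
Lemma Ck_inv k (f : V -> R) : (forall y, D y -> f y != 0) -> Ck k D f ->
  Ck k D (fun z => (f z)^-1).
Proof.
move=> f0; elim: k => [|k IH] Cf; split=> //.
- by move=> y Dy; apply: (@differentiableV _ _ f); [exact: Cf.1 | exact: f0].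
- by move=> y Dy; apply: (@differentiableV _ _ f); [exact: Cf.1 | exact: f0].
move=> v.
apply: (@Ck_eq _ _ (fun y => (-1) * ((f y)^-1 * (f y)^-1 * 'D_v f y))) => [y Dy|].
  rewrite (@deriveV _ _ f); [|exact: f0|apply: diff_derivable; exact: Cf.1].
  by rewrite /GRing.scale/= expr2 invfM mulN1r mulNr.
have Ci := IH (CkW Cf).
by apply: Ck_mul; [exact: Ck_cst | apply: Ck_mul; [exact: Ck_mul | exact: Cf.2]].
Qed.

Lemma Ck_entry m l k (F : V -> 'M[R]_(m, l)) i j :
  Ck k D F -> Ck k D (fun z => F z i j : R).
Proof.
elim: k F => [|k IH] F CF; split=> //.
- by move=> y Dy; apply: differentiable_entry; exact: CF.1.
- by move=> y Dy; apply: differentiable_entry; exact: CF.1.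
move=> v; apply: Ck_eq (IH _ (CF.2 v)) => y Dy.
by rewrite derive_entry//; exact: CF.1.
Qed.

Lemma Ck_mx m l k (F : V -> 'M[R]_(m, l)) :
  (forall i j, Ck k D (fun z => F z i j : R)) -> Ck k D F.
Proof.
elim: k F => [|k IH] F CF; split=> //.
- by move=> y Dy; apply: differentiable_mx => i j; exact: (CF i j).1.
- by move=> y Dy; apply: differentiable_mx => i j; exact: (CF i j).1.
move=> v; apply: IH => i j; apply: Ck_eq ((CF i j).2 v) => y Dy.
by rewrite derive_entry//; apply: differentiable_mx => i' j'; exact: (CF i' j').1.
Qed.

Lemma smooth_entry m l (F : V -> 'M[R]_(m, l)) i j :
  smooth_on D F -> smooth_on D (fun z => F z i j : R).
Proof. by move=> /smooth_onP sF; apply/smooth_onP => k; exact: Ck_entry. Qed.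

Lemma smooth_mx m l (F : V -> 'M[R]_(m, l)) :
  (forall i j, smooth_on D (fun z => F z i j : R)) -> smooth_on D F.
Proof.
move=> sF; apply/smooth_onP => k; apply: Ck_mx => i j.
by have /smooth_onP := sF i j; exact.
Qed.

Lemma smooth_cst (W : normedModType R) (c : W) : smooth_on D (fun=> c).
Proof. by apply/smooth_onP => k; exact: Ck_cst. Qed.

Lemma smooth_mulmx m k l (F : V -> 'M[R]_(m, k)) (G : V -> 'M[R]_(k, l)) :
  smooth_on D F -> smooth_on D G -> smooth_on D (fun z => F z *m G z).
Proof.
move=> sF sG; apply: smooth_mx => i j; under eq_fun do rewrite mxE.
apply/smooth_onP => q; apply: Ck_sum => p; apply: Ck_mul.
  by have /smooth_onP := smooth_entry i p sF; apply.
by have /smooth_onP := smooth_entry p j sG; apply.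
Qed.

Lemma Ck_det m k (F : V -> 'M[R]_m) : Ck k D F -> Ck k D (fun z => \det (F z) : R).
Proof.
move=> CF; rewrite /determinant; apply: Ck_sum => s; apply: Ck_mul; first exact: Ck_cst.
by apply: Ck_prod => i; exact: Ck_entry.
Qed.

Lemma smooth_invmx m (F : V -> 'M[R]_m) : smooth_on D F ->
  (forall y, D y -> F y \in unitmx) -> smooth_on D (fun z => invmx (F z)).
Proof.
move=> /smooth_onP sF uF; apply/smooth_onP => k; apply: Ck_mx => i j.
apply: (@Ck_eq _ _ (fun z => (\det (F z))^-1 *
    ((-1) ^+ (j + i) * \det (row' j (col' i (F z)))))) => [y Dy|].
  by rewrite /invmx uF// !mxE.
apply: Ck_mul.
  by apply: Ck_inv; [move=> y Dy; have := uF y Dy; rewrite unitmxE unitfE | exact: Ck_det].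
apply: Ck_mul; first exact: Ck_cst.
apply: Ck_det; apply: Ck_mx => i' j'.
by under eq_fun do rewrite !mxE; exact: Ck_entry.
Qed.

End OnOpen.

Lemma derive_prod (I : finType) (f : I -> V -> R) y v :
  (forall i, differentiable (f i) y) ->
  'D_v (fun z => \prod_i f i z) y = \sum_i 'D_v (f i) y * \prod_(j | j != i) f j y.
Proof.
move=> df.
suff H (s : seq I) : uniq s ->
    differentiable (fun z => \prod_(i <- s) f i z) y /\
    'D_v (fun z => \prod_(i <- s) f i z) y
    = \sum_(i <- s) 'D_v (f i) y * \prod_(j <- s | j != i) f j y.
  by have [_ ->] := H _ (index_enum_uniq I).
elim: s => [_|i s IH /= /andP[nis us]].
  by under eq_fun do rewrite big_nil; rewrite big_nil derive_cst.
have [dp Dp] := IH us.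
have -> : (fun z => \prod_(i0 <- i :: s) f i0 z)
    = (fun z => f i z * \prod_(i0 <- s) f i0 z).
  by apply/funext => z; rewrite big_cons.
split; first exact: differentiable_mulr.
rewrite derive_mulr// big_cons [in RHS]big_cons eqxx/=; congr (_ * _ + _).
  rewrite big_seq [RHS]big_seq_cond; apply: eq_bigl => j.
  by have [js|] := boolP (j \in s) => //=; apply/esym; apply: contraNneq nis => <-.
rewrite Dp mulr_sumr big_seq [RHS]big_seq; apply: eq_bigr => j js.
have ij : i != j by apply: contraNneq nis => ->.
by rewrite big_cons ij mulrCA.
Qed.

(** Jacobi's formula: the product rule applied to the Leibniz expansion
    differentiates one row at a time, and expanding along that row produces the
    adjugate. *)
Lemma derive_det m (F : V -> 'M[R]_m) y v : differentiable F y ->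
  'D_v (fun z => \det (F z)) y = \tr (\adj (F y) *m 'D_v F y).
Proof.
move=> dF; have dFe i j := differentiable_entry i j dF.
have dprod (s : 'S_m) : differentiable (fun z => \prod_i F z i (s i)) y.
  have : Ck 0 [set y] (fun z => \prod_i F z i (s i)).
    elim: (index_enum _) => [|i l IH].
      by under eq_fun do rewrite big_nil; split.
    under eq_fun do rewrite big_cons; split=> // z ->.
    by apply: differentiable_mulr => //; exact: IH.1.
  by case=> + _; apply.
rewrite /determinant derive_bigsum => [|s]; last exact: differentiable_mulr.
transitivity (\sum_i \det (\matrix_(k, j) if k == i then ('D_v F y) i j else F y k j)).
  rewrite /determinant exchange_big/=; apply: eq_bigr => s _.
  rewrite derive_scalar// derive_prod// mulr_sumr; apply: eq_bigr => i _.
  congr (_ * _); rewrite [RHS](bigD1 i)//= mxE eqxx derive_entry//; congr (_ * _).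
  by apply: eq_bigr => j /negPf ji; rewrite mxE ji.
rewrite mxtrace_mulC /mxtrace; apply: eq_bigr => i _.
rewrite (expand_det_row _ i) mxE; apply: eq_bigr => j _.
rewrite !mxE eqxx; congr (_ * _).
rewrite /cofactor; congr (_ * \det _); apply/matrixP => a b.
by rewrite !mxE eq_sym (negPf (neq_lift _ _)).
Qed.

End Calculus.

(** * The Levi-Civita connection of a Kähler metric in a chart *)

Section StdJ.
Variables (R : realType) (n : nat).
Local Notation J := (@stdJ R n).

Lemma stdJ_sqr : J *m J = - 1%:M.
Proof.
rewrite scalar_mx_block opp_block_mx oppr0 /stdJ mulmx_block.
by rewrite !mulmx0 !mul0mx !mulmx1 !mul1mx !add0r !addr0.
Qed.

Lemma stdJ_tr : J^T = - J.
Proof.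
by rewrite /stdJ tr_block_mx !trmx0 linearN/= trmx1 opp_block_mx oppr0 opprK.
Qed.

Lemma stdJK m (u : 'M[R]_(n + n, m)) : J *m (J *m u) = - u.
Proof. by rewrite mulmxA stdJ_sqr mulNmx mul1mx. Qed.

End StdJ.

Section Bilinear.
Variable R : comNzRingType.

Definition bilf m k (X : 'M[R]_(m, k)) (u : 'cV[R]_m) (v : 'cV[R]_k) : R :=
  (u^T *m X *m v) 0 0.

Lemma bilfE m k (X : 'M[R]_(m, k)) u v :
  bilf X u v = \sum_i \sum_j u i 0 * X i j * v j 0.
Proof.
rewrite /bilf mxE exchange_big; apply: eq_bigr => j _.
by rewrite !mxE mulr_suml; apply: eq_bigr => i _; rewrite mxE.
Qed.

Lemma bilf_tr m k (X : 'M[R]_(m, k)) u v : bilf X^T v u = bilf X u v.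
Proof.
rewrite !bilfE exchange_big/=; apply: eq_bigr => i _; apply: eq_bigr => j _.
by rewrite mxE; ring.
Qed.

Lemma bilf_delta m k (X : 'M[R]_(m, k)) i j :
  bilf X (delta_mx i 0) (delta_mx j 0) = X i j.
Proof. by rewrite /bilf trmx_delta -rowE -colE !mxE. Qed.

Lemma bilf_coordl m k (X : 'M[R]_(m, k)) u v :
  bilf X u v = \sum_i u i 0 * bilf X (delta_mx i 0) v.
Proof.
rewrite bilfE; apply: eq_bigr => i _.
rewrite /bilf trmx_delta -rowE !mxE mulr_sumr; apply: eq_bigr => j _.
by rewrite !mxE mulrA.
Qed.

Lemma bilf_coordr m k (X : 'M[R]_(m, k)) u v :
  bilf X u v = \sum_j v j 0 * bilf X u (delta_mx j 0).
Proof.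
rewrite -bilf_tr bilf_coordl; apply: eq_bigr => j _; by rewrite bilf_tr.
Qed.

Lemma bilf_ext m k (X Y : 'M[R]_(m, k)) :
  (forall u v, bilf X u v = bilf Y u v) -> X = Y.
Proof. by move=> H; apply/matrixP => i j; rewrite -!bilf_delta H. Qed.

Lemma bilfDm m k (X Y : 'M[R]_(m, k)) u v :
  bilf (X + Y) u v = bilf X u v + bilf Y u v.
Proof. by rewrite /bilf mulmxDr mulmxDl mxE. Qed.

Lemma bilfNm m k (X : 'M[R]_(m, k)) u v : bilf (- X) u v = - bilf X u v.
Proof. by rewrite /bilf mulmxN mulNmx mxE. Qed.

Lemma bilfNl m k (X : 'M[R]_(m, k)) u v : bilf X (- u) v = - bilf X u v.
Proof. by rewrite /bilf linearN/= !mulNmx mxE. Qed.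

Lemma bilfNr m k (X : 'M[R]_(m, k)) u v : bilf X u (- v) = - bilf X u v.
Proof. by rewrite /bilf !mulmxN mxE. Qed.

Lemma bilfMl m k p (A : 'M[R]_(m, p)) (X : 'M[R]_(m, k)) u v :
  bilf X (A *m u) v = bilf (A^T *m X) u v.
Proof. by rewrite /bilf trmx_mul !mulmxA. Qed.

Lemma bilfMr m k p (A : 'M[R]_(k, p)) (X : 'M[R]_(m, k)) u v :
  bilf X u (A *m v) = bilf (X *m A) u v.
Proof. by rewrite /bilf !mulmxA. Qed.

End Bilinear.

(** A vector of the kernel would have length zero. *)
Lemma posdef_unitmx (R : realType) d (G : 'M[R]_d) :
  (forall v, v != 0 -> 0 < bilf G v v) -> G \in unitmx.
Proof.
move=> pos; rewrite -row_full_unit -[row_full _]negbK; apply/negP => nf.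
have : kermx G^T != 0.
  by rewrite kermx_eq0 row_free_unit unitmx_tr -row_full_unit.
case/rowV0Pn => v /sub_kermxP vG v0.
have := pos v^T; rewrite /bilf trmxK -mulmxA -[G *m _]trmxK trmx_mul trmxK vG.
by rewrite trmx0 mulmx0 mxE ltxx => /(_ _)/negP; rewrite -trmx0 (inj_eq trmx_inj) => /(_ v0).
Qed.

(** [G] stands for the metric at a point, [DG w] for its derivative along [w] and
    [Gam w] for the connection matrix.  Keeping these abstract separates the
    algebra of the connection from the differentiation that produces it. *)
Section PointwiseConnection.
Variables (R : realType) (d : nat).
Local Notation V := 'cV[R]_d.
Variables (G : 'M[R]_d) (DG Gam : V -> 'M[R]_d).
Hypothesis posG : forall v : V, v != 0 -> 0 < bilf G v v.
Hypothesis symG : G^T = G.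
Hypothesis symDG : forall w, (DG w)^T = DG w.
Hypothesis dirDG : forall w, DG w = \sum_i w i 0 *: DG (basis_vec R i).
Hypothesis GamE : forall w l j, (G *m Gam w) l j = 2^-1 * \sum_i w i 0 *
  (DG (basis_vec R i) j l + DG (basis_vec R j) i l - DG (basis_vec R l) i j).

Local Notation q w := (bilf (DG w)).

Lemma DG_dir w u v : q w u v = \sum_i w i 0 * q (basis_vec R i) u v.
Proof.
rewrite dirDG /bilf mulmx_sumr mulmx_suml summxE; apply: eq_bigr => i _.
by rewrite -scalemxAr -scalemxAl mxE.
Qed.

Lemma DG_sym w u v : q w u v = q w v u.
Proof. by rewrite -bilf_tr symDG. Qed.

(** Koszul's formula for constant vector fields, whose brackets vanish. *)
Lemma koszul u v w :
  2 * bilf G u (Gam w *m v) = q w v u + q v w u - q u w v.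
Proof.
pose M2 := \matrix_(l, j) q (basis_vec R j) w (basis_vec R l).
pose M3 := \matrix_(l, j) q (basis_vec R l) w (basis_vec R j).
have -> : q w v u = bilf (DG w) u v by exact: DG_sym.
have -> : q v w u = bilf M2 u v.
  rewrite DG_dir bilf_coordr; apply: eq_bigr => j _; congr (_ * _).
  rewrite bilf_coordr bilf_coordl; apply: eq_bigr => l _; congr (_ * _).
  by rewrite bilf_delta mxE.
have -> : q u w v = bilf M3 u v.
  rewrite DG_dir bilf_coordl; apply: eq_bigr => l _; congr (_ * _).
  rewrite bilf_coordr [RHS]bilf_coordr; apply: eq_bigr => j _; congr (_ * _).
  by rewrite bilf_delta mxE.
have E : G *m Gam w = 2^-1 *: (DG w + M2 - M3).
  apply/matrixP => l j; rewrite GamE 3!mxE; congr (_ * _).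
  under eq_bigr do rewrite mulrBr mulrDr.
  rewrite sumrB big_split/= [in RHS]mxE !mxE; congr (_ + _ - _).
  - by rewrite -[DG w l j]bilf_delta DG_sym DG_dir; apply: eq_bigr => i _; rewrite bilf_delta.
  - by rewrite bilf_coordl; apply: eq_bigr => i _; rewrite bilf_delta.
  - by rewrite bilf_coordl; apply: eq_bigr => i _; rewrite bilf_delta.
rewrite bilfMr E -[2^-1 *: _]mul_scalar_mx.
rewrite -bilfNm -!bilfDm /bilf mulmxA mul_mx_scalar -!scalemxAl mxE.
by rewrite mulrA divff ?mul1r// pnatr_eq0.
Qed.

Lemma bilf_inj x x' : (forall u, bilf G u x = bilf G u x') -> x = x'.
Proof.
have G_unit := posdef_unitmx posG.
move=> H; have E : G *m x = G *m x'.
  apply/matrixP => i j; rewrite ord1; have := H (delta_mx i 0).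
  by rewrite /bilf trmx_delta -!mulmxA -!rowE !mxE.
by rewrite -[x](mulKmx G_unit) E mulKmx.
Qed.

Lemma Gam_sym u v : Gam u *m v = Gam v *m u.
Proof.
apply: bilf_inj => x; have := koszul x v u; have := koszul x u v.
rewrite (DG_sym x v u); lra.
Qed.

Lemma Gam_metric w : DG w = (Gam w)^T *m G + G *m Gam w.
Proof.
apply: bilf_ext => u v; rewrite bilfDm -bilfMl -bilfMr.
rewrite -[bilf _ (_ *m u) v]bilf_tr symG.
have := koszul u v w; have := koszul v u w.
rewrite (DG_sym w v u); lra.
Qed.

End PointwiseConnection.

(** The bilinear form of [X] being J-invariant and J squaring to -1, J is
    skew-adjoint for it. *)
Lemma herm_anti (R : realType) n (X : 'M[R]_(n + n)) u v :
  (stdJ R n)^T *m X *m stdJ R n = X ->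
  bilf X (stdJ R n *m u) v = - bilf X u (stdJ R n *m v).
Proof.
move=> XJ; rewrite bilfMl bilfMr -bilfNm; congr bilf.
by rewrite -[in RHS]XJ -!mulmxA stdJ_sqr !mulmxN mulmx1 opprK.
Qed.

Section PointwiseKahler.
Variables (R : realType) (n : nat).
Local Notation V := 'cV[R]_(n + n).
Variables (G : 'M[R]_(n + n)) (DG Gam : V -> 'M[R]_(n + n)).
Local Notation J := (@stdJ R n).
Local Notation q w := (bilf (DG w)).
Hypothesis posG : forall v : V, v != 0 -> 0 < bilf G v v.
Hypothesis symDG : forall w, (DG w)^T = DG w.
Hypothesis kosz : forall u v w,
  2 * bilf G u (Gam w *m v) = q w v u + q v w u - q u w v.
Hypothesis symGam : forall u v, Gam u *m v = Gam v *m u.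
Hypothesis hermG : J^T *m G *m J = G.
Hypothesis hermDG : forall w, J^T *m DG w *m J = DG w.
Hypothesis dclosed : forall u v w,
  q u (J *m v) w + q v (J *m w) u + q w (J *m u) v = 0.

(** Both sides are tested against [u] by Koszul's formula, at (u, J v, w) and at
    (J u, v, w); the terms that do not cancel by J-invariance are those of
    d omega at (w, v, u) and at (w, J v, J u). *)
Lemma Gam_J w : Gam w *m J = J *m Gam w.
Proof.
suff H (v : V) : Gam w *m (J *m v) = J *m (Gam w *m v).
  apply/matrixP => i j; have := H (delta_mx j 0).
  by rewrite !mulmxA -!colE => /matrixP/(_ i 0); rewrite !mxE.
apply: (bilf_inj posG) => u.
have := kosz u (J *m v) w.
have := kosz (J *m u) v w.
have := dclosed w v u; have := dclosed w (J *m v) (J *m u).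
rewrite !stdJK !(bilfNl, bilfNr).
have HD a b c := @herm_anti _ _ _ b c (hermDG a).
have HG := herm_anti u (Gam w *m v) hermG.
rewrite !HD HG !stdJK !bilfNr.
have S := DG_sym symDG.
rewrite (S (J *m v) u w) (S v w (J *m u)) HD.
lra.
Qed.

(** Symmetry of the connection moves [J] from the direction to the argument. *)
Lemma Gam_Jdir w : Gam (J *m w) = J *m Gam w.
Proof.
suff H (v : V) : Gam (J *m w) *m v = J *m Gam w *m v.
  apply/matrixP => i j; have := H (delta_mx j 0).
  by rewrite -!colE => /matrixP/(_ i 0); rewrite !mxE.
by rewrite symGam mulmxA Gam_J -!mulmxA symGam.
Qed.

End PointwiseKahler.

Section LeviCivita.
Variables (R : realType) (d : nat) (D : set 'cV[R]_d) (G : 'cV[R]_d -> 'M[R]_d).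
Local Notation V := 'cV[R]_d.
Hypotheses (oD : open D) (sG : smooth_on D G).
Hypothesis symG : forall y, D y -> (G y)^T = G y.
Hypothesis posG : forall y, D y -> forall v : V, v != 0 -> 0 < bilf (G y) v v.
Variables (y : V) (Dy : D y).

Let dG : differentiable G y. Proof. exact: (sG [::]). Qed.

Lemma dG_sym w : ('D_w G y)^T = 'D_w G y.
Proof.
apply/matrixP => i j; rewrite mxE !derive_entry//.
apply: (derive_eq_on _ oD _ Dy) => z Dz.
by rewrite -{1}(symG Dz) mxE.
Qed.

Lemma G_conn w l j : (G y *m conn G y w) l j = 2^-1 * \sum_i w i 0 *
  ('D_(basis_vec R i) G y j l + 'D_(basis_vec R j) G y i l
   - 'D_(basis_vec R l) G y i j).
Proof.
pose T i := \col_p ('D_(basis_vec R i) (fun z => G z j p) y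
     + 'D_(basis_vec R j) (fun z => G z i p) y
     - 'D_(basis_vec R p) (fun z => G z i j) y).
have -> : conn G y w = \matrix_(k, j) \sum_i christoffel G y k i j * w i 0 by [].
transitivity ((G y *m (2^-1 *: (invmx (G y) *m \sum_i w i 0 *: T i))) l 0).
  rewrite 2!mxE; apply: eq_bigr => k _; congr (_ * _).
  rewrite !mxE; under [in RHS]eq_bigr do rewrite summxE mulr_sumr.
  rewrite exchange_big mulr_sumr /=; apply: eq_bigr => i _.
  rewrite /christoffel mulrC mulrCA; congr (_ * _).
  rewrite mulr_sumr; apply: eq_bigr => p _.
  by rewrite 2!mxE mulrCA.
rewrite -scalemxAr mulKVmx; last by apply: posdef_unitmx => v; exact: posG.
rewrite mxE summxE; congr (_ * _); apply: eq_bigr => i _; rewrite 2!mxE.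
have E v a b : 'D_v G y a b = 'D_v (fun z => G z a b) y by exact: derive_entry.
by rewrite (E _ j l) (E _ i l) (E _ i j).
Qed.

Lemma conn_koszul u v w : 2 * bilf (G y) u (conn G y w *m v)
  = bilf ('D_w G y) v u + bilf ('D_v G y) w u - bilf ('D_u G y) w v.
Proof.
apply: (@koszul _ _ (G y) (fun w => 'D_w G y) (conn G y)).
- exact: dG_sym.
- by move=> w'; exact: derive_dir_sum.
- exact: G_conn.
Qed.

Lemma conn_sym u v : conn G y u *m v = conn G y v *m u.
Proof.
apply: (@Gam_sym _ _ (G y) (fun w => 'D_w G y) (conn G y)).
- exact: posG.
- exact: dG_sym.
- by move=> w'; exact: derive_dir_sum.
- exact: G_conn.
Qed.

Lemma conn_metric w : 'D_w G y = (conn G y w)^T *m G y + G y *m conn G y w.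
Proof.
apply: (@Gam_metric _ _ (G y) (fun w => 'D_w G y) (conn G y)).
- exact: symG.
- exact: dG_sym.
- by move=> w'; exact: derive_dir_sum.
- exact: G_conn.
Qed.

End LeviCivita.

Section KahlerChart.
Variables (R : realType) (n : nat).
Local Notation V := 'cV[R]_(n + n).
Variables (D : set V) (G : V -> 'M[R]_(n + n)).
Local Notation J := (@stdJ R n).
Hypotheses (oD : open D) (sG : smooth_on D G).
Hypothesis symG : forall y, D y -> (G y)^T = G y.
Hypothesis posG : forall y, D y -> forall v : V, v != 0 -> 0 < bilf (G y) v v.
Hypothesis hermG : forall y, D y -> J^T *m G y *m J = G y.
Hypothesis closedG : forall y, D y -> forall u v w : V,
    'D_u (fun z => ((J *m v)^T *m G z *m w) 0 0) y
    + 'D_v (fun z => ((J *m w)^T *m G z *m u) 0 0) y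
    + 'D_w (fun z => ((J *m u)^T *m G z *m v) 0 0) y = 0.
Variables (y : V) (Dy : D y).

Let dG : differentiable G y. Proof. exact: (sG [::]). Qed.

Lemma dG_herm w : J^T *m 'D_w G y *m J = 'D_w G y.
Proof.
have dJG : differentiable (fun z => J^T *m G z) y.
  by apply: differentiable_mulmx => //; exact: differentiable_cst.
rewrite -derive_constmx// -derive_mxconst//.
by apply: (derive_eq_on _ oD _ Dy) => z Dz; exact: hermG.
Qed.

Lemma dG_closed u v w : bilf ('D_u G y) (J *m v) w
  + bilf ('D_v G y) (J *m w) u + bilf ('D_w G y) (J *m u) v = 0.
Proof.
have H a b c : 'D_a (fun z => ((J *m b)^T *m G z *m c) 0 0) y
    = bilf ('D_a G y) (J *m b) c.
  have dbG : differentiable (fun z => (J *m b)^T *m G z) y.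
    by apply: differentiable_mulmx => //; exact: differentiable_cst.
  rewrite -derive_entry; last first.
    by apply: differentiable_mulmx => //; exact: differentiable_cst.
  by rewrite derive_mxconst// derive_constmx.
by have := closedG Dy u v w; rewrite !H.
Qed.

Lemma conn_J w : conn G y w *m J = J *m conn G y w.
Proof.
apply: (@Gam_J _ _ (G y) (fun w => 'D_w G y)).
- exact: posG.
- exact: (dG_sym oD sG symG Dy).
- exact: (conn_koszul oD sG symG posG Dy).
- exact: hermG.
- exact: dG_herm.
- exact: dG_closed.
Qed.

Lemma conn_Jdir w : conn G y (J *m w) = J *m conn G y w.
Proof.
apply: (@Gam_Jdir _ _ (G y) (fun w => 'D_w G y)).
- exact: posG.
- exact: (dG_sym oD sG symG Dy).
- exact: (conn_koszul oD sG symG posG Dy).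
- exact: (conn_sym oD sG symG posG Dy).
- exact: hermG.
- exact: dG_herm.
- exact: dG_closed.
Qed.

End KahlerChart.

(** * Pointwise algebra of forms of type (k,0) *)

Lemma dfwith_id (I : eqType) (T : Type) (v : I -> T) i : dfwith v i (v i) = v.
Proof. by apply/funext => j; case: dfwithP. Qed.

Lemma dfwith_dfwith (I : eqType) (T : Type) (v : I -> T) i (x x' : T) :
  dfwith (dfwith v i x) i x' = dfwith v i x'.
Proof.
apply/funext => j; case: (dfwithP _ x') => [|k ik]; first by rewrite dfwithin.
by rewrite !dfwithout.
Qed.

Lemma dfwith_swap (I : eqType) (T : Type) (v : I -> T) i j (x x' : T) : i != j ->
  dfwith (dfwith v i x) j x' = dfwith (dfwith v j x') i x.
Proof.
move=> ij; apply/funext => k; case: dfwithP => [|l jl].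
  by rewrite dfwithout// dfwithin.
have [<-|il] := eqVneq i l; first by rewrite !dfwithin.
by rewrite !dfwithout.
Qed.

Section ComplexCoordinates.
Variables (R : realType) (n : nat).
Local Notation d := (n + n)%N.
Local Notation VC := 'cV[R[i]]_d.
Local Notation J := (@stdJ R n).
Local Notation JC := (cplx_mx J).

Lemma cplx_mxM m k l (A : 'M[R]_(m, k)) (B : 'M[R]_(k, l)) :
  cplx_mx (A *m B) = cplx_mx A *m cplx_mx B.
Proof. by rewrite /cplx_mx map_mxM. Qed.

Lemma cplx_mxD m k (A B : 'M[R]_(m, k)) : cplx_mx (A + B) = cplx_mx A + cplx_mx B.
Proof. by rewrite /cplx_mx map_mxD. Qed.

Lemma cplx_mxN m k (A : 'M[R]_(m, k)) : cplx_mx (- A) = - cplx_mx A.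
Proof. by rewrite /cplx_mx map_mxN. Qed.

Lemma cplx_mx1 m : cplx_mx (1%:M : 'M[R]_m) = 1%:M.
Proof. by rewrite /cplx_mx map_mx1. Qed.

Lemma cplx_basis m (j : 'I_m) : cplx_mx (basis_vec R j) = delta_mx j 0.
Proof. by rewrite /cplx_mx map_delta_mx. Qed.

Lemma mulii : 'i%C * 'i%C = -1 :> R[i].
Proof. by rewrite -expr2 sqr_i. Qed.

Lemma JCK m (u : 'M[R[i]]_(d, m)) : JC *m (JC *m u) = - u.
Proof.
by rewrite mulmxA -cplx_mxM stdJ_sqr cplx_mxN cplx_mx1 mulNmx mul1mx.
Qed.

Lemma T01_JC (u : VC) : T01 (JC *m u - 'i%C *: u).
Proof.
rewrite /T01 mulmxBr JCK -scalemxAr scalerBr scalerA.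
by rewrite mulNr mulii opprK scale1r scaleNr [RHS]addrC.
Qed.

Lemma T01_real (u : 'cV[R]_d) : T01 (cplx_mx u + 'i%C *: cplx_mx (J *m u)).
Proof.
rewrite /T01 mulmxDr -scalemxAr cplx_mxM JCK -cplx_mxM.
by rewrite scalerDr scalerA mulNr mulii opprK scale1r scaleNr scalerN addrC.
Qed.

Lemma T10_real (u : 'cV[R]_d) : T10 (cplx_mx u - 'i%C *: cplx_mx (J *m u)).
Proof.
rewrite /T10 mulmxBr -scalemxAr cplx_mxM JCK -cplx_mxM.
by rewrite scalerBr scalerA mulii scalerN opprK scaleN1r opprK addrC.
Qed.

Lemma T10Z c (u : VC) : T10 u -> T10 (c *: u).
Proof. by rewrite /T10 -scalemxAr => ->; rewrite !scalerA mulrC. Qed.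

End ComplexCoordinates.

Section PointwiseForms.
Variables (R : realType) (n k : nat).
Local Notation d := (n + n)%N.
Local Notation VC := 'cV[R[i]]_d.
Local Notation J := (@stdJ R n).
Local Notation JC := (cplx_mx J).

(** The fibre at a point of the bundle of forms of type (k,0). *)
Definition form_at (f : ('I_k -> VC) -> R[i]) : Prop :=
  [/\ forall v i c u w,
        f (dfwith v i (c *: u + w)) = c * f (dfwith v i u) + f (dfwith v i w),
      forall v i j, i != j -> v i = v j -> f v = 0
    & forall v i, T01 (v i) -> f v = 0].

Variables (f : ('I_k -> VC) -> R[i]) (fP : form_at f).

Lemma kformD v i u w : f (dfwith v i (u + w)) = f (dfwith v i u) + f (dfwith v i w).
Proof. by have [L _ _] := fP; have := L v i 1 u w; rewrite scale1r mul1r. Qed.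

Lemma kform0 v i : f (dfwith v i 0) = 0.
Proof.
by have [L _ _] := fP; have := L v i (-1) 0 0; rewrite scaler0 addr0 mulN1r addNr.
Qed.

Lemma kformZ v i c u : f (dfwith v i (c *: u)) = c * f (dfwith v i u).
Proof. by have [L _ _] := fP; have := L v i c u 0; rewrite addr0 kform0 addr0. Qed.

Lemma kformB v i u w : f (dfwith v i (u - w)) = f (dfwith v i u) - f (dfwith v i w).
Proof. by rewrite kformD -scaleN1r kformZ mulN1r. Qed.

Lemma kform_sum v i m (c : 'I_m -> R[i]) (u : 'I_m -> VC) :
  f (dfwith v i (\sum_j c j *: u j)) = \sum_j c j * f (dfwith v i (u j)).
Proof.
elim/big_ind2 : _ => [|x x' y y' E E'|j _]; rewrite ?kform0 ?kformZ//.
by rewrite kformD E E'.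
Qed.

(** [JC *m u - 'i *: u] is of type (0,1). *)
Lemma kform_J v i u : f (dfwith v i (JC *m u)) = 'i%C * f (dfwith v i u).
Proof.
apply/eqP; rewrite -subr_eq0 -kformZ -kformB; apply/eqP.
have [_ _ T] := fP; apply: (T _ i); rewrite dfwithin; exact: T01_JC.
Qed.

(** The sum [u + w] is put in both slots and expanded. *)
Lemma kform_swap v i j u w : i != j ->
  f (dfwith (dfwith v i u) j w) = - f (dfwith (dfwith v i w) j u).
Proof.
move=> ij; have [_ alt _] := fP.
have A x : f (dfwith (dfwith v i x) j x) = 0.
  by apply: (alt _ i j ij); rewrite dfwithin dfwithout 1?eq_sym// dfwithin.
have ji : j != i by rewrite eq_sym.
have := A (u + w); rewrite kformD !(dfwith_swap _ _ _ ij) !kformD.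
rewrite -!(dfwith_swap _ _ _ ij) !A add0r addr0 => /eqP.
by rewrite addr_eq0 => /eqP ->; rewrite opprK.
Qed.

End PointwiseForms.

Section LastArgument.
Variables (R : realType) (n r : nat).
Local Notation VC := 'cV[R[i]]_(n + n).

Lemma rcons_vec_max (e : 'I_r -> VC) w : rcons_vec e w ord_max = w.
Proof. by rewrite /rcons_vec unlift_none. Qed.

Lemma rcons_vec_lift (e : 'I_r -> VC) w i : rcons_vec e w (lift ord_max i) = e i.
Proof. by rewrite /rcons_vec liftK. Qed.

Lemma rcons_vecE (e : 'I_r -> VC) w w' :
  rcons_vec e w = dfwith (rcons_vec e w') ord_max w.
Proof.
apply/funext => j; case: dfwithP => [|l]; first exact: rcons_vec_max.
by case: (unliftP ord_max l) => [i -> _|-> /eqP//]; rewrite !rcons_vec_lift.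
Qed.

Lemma rcons_vec_dfwith (e : 'I_r -> VC) w i u :
  rcons_vec (dfwith e i u) w = dfwith (rcons_vec e w) (lift ord_max i) u.
Proof.
apply/funext => j; case: dfwithP => [|l]; first by rewrite rcons_vec_lift dfwithin.
case: (unliftP ord_max l) => [i' -> ii'|-> _]; last by rewrite !rcons_vec_max.
rewrite !rcons_vec_lift dfwithout//.
by apply: contraNneq ii' => ->.
Qed.

Variables (f : ('I_r.+1 -> VC) -> R[i]) (fP : form_at f).

Lemma rcons_sum e m (c : 'I_m -> R[i]) (u : 'I_m -> VC) :
  f (rcons_vec e (\sum_j c j *: u j)) = \sum_j c j * f (rcons_vec e (u j)).
Proof.
rewrite (rcons_vecE _ _ 0) (kform_sum fP).
by apply: eq_bigr => j _; rewrite -rcons_vecE.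
Qed.

(** The norm of the contracted form only sees its values on the real coordinate
    frame; this recovers all the others. *)
Lemma rcons_coord e w :
  f (rcons_vec e w) = \sum_j w j 0 * f (rcons_vec e (cplx_mx (basis_vec R j))).
Proof.
rewrite {1}[w]matrix_sum_delta -rcons_sum; congr (f (rcons_vec e _)).
by apply: eq_bigr => j _; rewrite big_ord1 cplx_basis.
Qed.

End LastArgument.

(** * Unitary frames *)

Section Conj.
Variable R : realType.
Implicit Types x y : R[i].

Lemma conjcD x y : (x + y)^*%C = x^*%C + y^*%C.
Proof. exact: rmorphD. Qed.

Lemma conjcN x : (- x)^*%C = - x^*%C.
Proof. exact: rmorphN. Qed.

Lemma conjcM x y : (x * y)^*%C = x^*%C * y^*%C.
Proof. exact: rmorphM. Qed.

Lemma conjc_sum (I : finType) (F : I -> R[i]) :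
  (\sum_i F i)^*%C = \sum_i (F i)^*%C.
Proof. exact: rmorph_sum. Qed.

Lemma conjc_i : ('i%C)^*%C = - 'i%C :> R[i].
Proof. by apply/eqP; rewrite eq_complex/= oppr0 !eqxx. Qed.

End Conj.

Section Hermitian.
Variables (R : realType) (n : nat).
Local Notation d := (n + n)%N.
Local Notation C := R[i].
Local Notation VC := 'cV[C]_d.
Local Notation J := (@stdJ R n).
Local Notation JC := (cplx_mx J).
Local Notation conj_mx := (map_mx (@conjc R)).
Variable G : 'M[R]_d.
Hypothesis symG : G^T = G.
Hypothesis posG : forall v : 'cV[R]_d, v != 0 -> 0 < bilf G v v.
Hypothesis hermG : J^T *m G *m J = G.

Lemma conj_mxK m k (A : 'M[C]_(m, k)) : conj_mx (conj_mx A) = A.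
Proof. by apply/matrixP => i j; rewrite !mxE conjcK. Qed.

Lemma conj_mxM m k l (A : 'M[C]_(m, k)) (B : 'M[C]_(k, l)) :
  conj_mx (A *m B) = conj_mx A *m conj_mx B.
Proof. by rewrite map_mxM. Qed.

Lemma conj_cplx m k (A : 'M[R]_(m, k)) : conj_mx (cplx_mx A) = cplx_mx A.
Proof. by apply/matrixP => i j; rewrite !mxE conjc_real. Qed.

Lemma cplx_tr m k (A : 'M[R]_(m, k)) : (cplx_mx A)^T = cplx_mx A^T.
Proof. by rewrite /cplx_mx map_trmx. Qed.

Lemma hermDl u u' v : herm G (u + u') v = herm G u v + herm G u' v.
Proof. by rewrite /herm linearD/= !mulmxDl mxE. Qed.

Lemma hermZl c u v : herm G (c *: u) v = c * herm G u v.
Proof. by rewrite /herm linearZ/= -!scalemxAl mxE. Qed.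

Lemma hermE u v : herm G u v = \sum_i \sum_j u i 0 * (G i j)%:C%C * (v j 0)^*%C.
Proof.
rewrite /herm mxE exchange_big; apply: eq_bigr => j _.
rewrite !mxE mulr_suml; apply: eq_bigr => i _; by rewrite !mxE.
Qed.

Lemma herm_conj u v : (herm G u v)^*%C = herm G v u.
Proof.
rewrite !hermE conjc_sum exchange_big; apply: eq_bigr => i _.
rewrite conjc_sum; apply: eq_bigr => j _.
rewrite !conjcM conjcK conjc_real -[in RHS]symG mxE; ring.
Qed.

Lemma hermDr u v v' : herm G u (v + v') = herm G u v + herm G u v'.
Proof. by rewrite -herm_conj hermDl conjcD !herm_conj. Qed.

Lemma hermZr c u v : herm G u (c *: v) = c^*%C * herm G u v.
Proof. by rewrite -herm_conj hermZl conjcM !herm_conj. Qed.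

Lemma herm_cplx (u v : 'cV[R]_d) :
  herm G (cplx_mx u) (cplx_mx v) = (bilf G u v)%:C%C.
Proof.
rewrite hermE bilfE rmorph_sum; apply: eq_bigr => i _.
rewrite rmorph_sum; apply: eq_bigr => j _.
by rewrite !mxE conjc_real !rmorphM.
Qed.

Lemma bilf_sym u v : bilf G u v = bilf G v u.
Proof. by rewrite -bilf_tr symG. Qed.

Lemma ReIm_mx m k (w : 'M[C]_(m, k)) : w = cplx_mx (map_mx (@complex.Re R) w)
   + 'i%C *: cplx_mx (map_mx (@complex.Im R) w).
Proof. by apply/matrixP => i j; rewrite !mxE -complexE. Qed.

Lemma herm_ReIm (p q : 'cV[R]_d) :
  herm G (cplx_mx p + 'i%C *: cplx_mx q) (cplx_mx p + 'i%C *: cplx_mx q)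
  = (bilf G p p + bilf G q q)%:C%C.
Proof.
rewrite !(hermDl, hermDr, hermZl, hermZr) !herm_cplx (bilf_sym q p) conjc_i.
rewrite [RHS]rmorphD.
have := mulii R; move: 'i%C => j jj.
transitivity ((bilf G p p)%:C%C - (j * j) * (bilf G q q)%:C%C); first by ring.
by rewrite jj; ring.
Qed.

Lemma herm_pos u : u != 0 -> exists2 l : R, 0 < l & herm G u u = l%:C%C.
Proof.
move=> u0; have E := ReIm_mx u; set p := map_mx _ u in E; set q := map_mx _ u in E.
exists (bilf G p p + bilf G q q); last by rewrite {1 2}E herm_ReIm.
have ge0 v : 0 <= bilf G v v.
  have [->|/posG/ltW//] := eqVneq v 0.
  by rewrite /bilf mulmx0 mxE.
have [p0|/posG p0] := eqVneq p 0; last exact: ltr_wpDr.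
have [q0|/posG q0] := eqVneq q 0; last exact: ltr_wpDl.
by move: u0; rewrite E p0 q0 /cplx_mx !map_mx0 scaler0 addr0 eqxx.
Qed.

(** The parametrisation x |-> (x, -ix) of the (1,0)-vectors by C^n. *)
Definition T10mx : 'M[C]_(d, n) := col_mx 1%:M (- 'i%C)%:M.

Lemma JC_T10mx : JC *m T10mx = 'i%C *: T10mx.
Proof.
have -> : JC = block_mx 0 (- 1%:M) 1%:M 0.
  by rewrite /cplx_mx map_block_mx !map_mx0 map_mxN map_mx1.
rewrite /T10mx mul_block_col !mul0mx add0r addr0 mulNmx !mul1mx.
rewrite scale_col_mx !scale_scalar_mx mulrN mulii opprK mulr1.
by rewrite -(raddfN (@scalar_mx C n)) opprK.
Qed.

(** One vector is added at a time: orthogonality to the [m] vectors already there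
    is a system of [m < n] linear equations on the (1,0)-vectors, and a nonzero
    solution can be normalised. *)
Lemma unitary_frame m : (m <= n)%N -> exists e : nat -> VC,
  (forall i, (i < m)%N -> T10 (e i)) /\
  (forall i j, (i < m)%N -> (j < m)%N -> herm G (e i) (e j) = (i == j)%:R).
Proof.
elim: m => [|m IH] mn; first by exists (fun=> 0).
have [e [Te He]] := IH (ltnW mn).
pose B : 'M[C]_(n, m) := \matrix_(k, j) herm G (col k T10mx) (e j).
have : kermx B != 0.
  rewrite -mxrank_eq0 mxrank_ker subn_eq0 -ltnNge.
  exact: leq_ltn_trans (rank_leq_col _) mn.
case/rowV0Pn => x /sub_kermxP xB x0.
pose f : VC := T10mx *m x^T.
have f0 : f != 0.
  apply: contraNneq x0; rewrite /f /T10mx mul_col_mx mul1mx -col_mx0.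
  by case/eq_col_mx => /eqP; rewrite -trmx0 (inj_eq trmx_inj).
have Tf : T10 f by rewrite /T10 /f mulmxA JC_T10mx scalemxAl.
have fE : f = \sum_k x 0 k *: col k T10mx.
  apply/colP => a; rewrite summxE mxE; apply: eq_bigr => k _.
  by rewrite !mxE mulrC.
have fe j : (j < m)%N -> herm G f (e j) = 0.
  move=> jm; have := congr1 (fun N : 'rV_m => N 0 (Ordinal jm)) xB.
  rewrite !mxE => <-; rewrite fE.
  have -> (I : finType) (F : I -> VC) v : herm G (\sum_k F k) v = \sum_k herm G (F k) v.
    by rewrite /herm linear_sum/= !mulmx_suml summxE.
  by apply: eq_bigr => k _; rewrite hermZl mxE.
have [l l0 El] := herm_pos f0.
pose s : C := (Num.sqrt l)^-1%:C%C.
have ss : s * s * l%:C%C = 1.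
  rewrite -!rmorphM/= -invfM -expr2 sqr_sqrtr ?mulVf ?gt_eqF ?rmorph1//.
  exact: ltW.
exists (fun i => if i == m then s *: f else e i); split.
  move=> i; rewrite ltnS leq_eqVlt => /orP[/eqP->|im].
    by rewrite eqxx; exact: T10Z.
  by rewrite ltn_eqF//; exact: Te.
have cs : (s^*)%C = s by exact: conjc_real.
move=> i j; rewrite 2!ltnS leq_eqVlt [(j <= m)%N]leq_eqVlt => /orP[/eqP->|im] /orP[/eqP->|jm].
- by rewrite !eqxx hermZl hermZr cs El mulrA ss.
- by rewrite eqxx (ltn_eqF jm) hermZl fe// mulr0 gtn_eqF.
- by rewrite eqxx (ltn_eqF im) hermZr -herm_conj fe// conjc0 mulr0.
- by rewrite (ltn_eqF im) (ltn_eqF jm) He.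
Qed.

(** Together with its conjugate, a unitary frame of the (1,0)-vectors diagonalises
    the metric: (1,0)-vectors are isotropic for its complex bilinear extension. *)
Lemma frame_full (e : 'I_n -> VC) (F := \matrix_(a, k) e k a 0)
    (U := row_mx F (conj_mx F)) :
  (forall i, T10 (e i)) ->
  (forall i j, herm G (e i) (e j) = (i == j)%:R) ->
  U^T *m (cplx_mx G *m conj_mx U) = 1%:M.
Proof.
move=> Te He.
pose GC := cplx_mx G.
have colF k : col k F = e k by apply/colP => a; rewrite !mxE.
have JF : JC *m F = 'i%C *: F.
  apply/matrixP => a k; have := Te k; rewrite /T10 -colF => /(congr1 (fun N : VC => N a 0)).
  by rewrite colE mulmxA scalemxAl -!colE mxE [in RHS]mxE.
have FF : F^T *m GC *m conj_mx F = 1%:M.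
  apply/matrixP => i j; rewrite [RHS]mxE -He hermE [LHS]mxE exchange_big.
  apply: eq_bigr => b _; rewrite !mxE mulr_suml; apply: eq_bigr => a _.
  by rewrite !mxE.
have F0 : F^T *m GC *m F = 0.
  have E : F^T *m GC *m F = - (F^T *m GC *m F).
    have {1}-> : GC = JC^T *m GC *m JC.
      by rewrite /GC cplx_tr -!cplx_mxM hermG.
    rewrite !mulmxA -trmx_mul -!mulmxA JF linearZ/= -!scalemxAl -!scalemxAr.
    by rewrite scalerA mulii scaleN1r !mulmxA.
  apply/eqP; have /eqP := E; rewrite -subr_eq0 opprK -mulr2n -scaler_nat scaler_eq0.
  by rewrite pnatr_eq0.
have cG : conj_mx GC = GC by exact: conj_cplx.
have cT : (conj_mx F)^T = conj_mx F^T by rewrite map_trmx.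
have F0c : (conj_mx F)^T *m GC *m conj_mx F = 0.
  by rewrite cT -cG -!conj_mxM F0 map_mx0.
have FFc : (conj_mx F)^T *m GC *m F = 1%:M.
  by rewrite cT -cG -[X in _ *m X]conj_mxK -!conj_mxM FF map_mx1.
rewrite mulmxA tr_row_mx mul_col_mx map_row_mx conj_mxK mul_col_row.
by rewrite F0 FF F0c FFc -scalar_mx_block.
Qed.

(** The covector norm, computed in a unitary frame: a covector of type (1,0)
    vanishes on the conjugate half of the full frame. *)
Lemma conorm_frame (e : 'I_n -> VC) (al : 'I_d -> C) :
  (forall i, T10 (e i)) ->
  (forall i j, herm G (e i) (e j) = (i == j)%:R) ->
  (forall k, \sum_a (e k a 0)^*%C * al a = 0) ->
  ((conorm G al) ^+ 2)%:C%C
  = \sum_k (\sum_a e k a 0 * al a) * (\sum_a e k a 0 * al a)^*%C.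
Proof.
move=> Te He al10; have UU := frame_full Te He.
set U := row_mx _ _ in UU.
have iG : cplx_mx (invmx G) = conj_mx U *m U^T.
  have E := mulmx1C UU; rewrite -mulmxA in E.
  rewrite -[LHS]mulmx1 -E !mulmxA -cplx_mxM mulVmx ?cplx_mx1 ?mul1mx//.
  exact: posdef_unitmx.
pose w k := \sum_a (U a k)^*%C * al a.
have SE : \sum_i \sum_j cplx_mx (invmx G) i j * al i * (al j)^*%C
    = \sum_k (\sum_a e k a 0 * al a) * (\sum_a e k a 0 * al a)^*%C.
  transitivity (\sum_k w k * (w k)^*%C).
    rewrite iG; under eq_bigr => i _ do under eq_bigr => j _ do
      rewrite mxE !mulr_suml.
    under eq_bigr => i _ do rewrite exchange_big/=.
    rewrite exchange_big/=; apply: eq_bigr => k _.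
    rewrite [in RHS]/w mulr_suml; apply: eq_bigr => i _.
    rewrite /w conjc_sum mulr_sumr; apply: eq_bigr => j _.
    rewrite conjcM conjcK !mxE; ring.
  rewrite big_split_ord/= big1 ?add0r => [|k _].
    apply: eq_bigr => k _; congr (_ * _^*%C); apply: eq_bigr => a _;
      by rewrite row_mxEr !mxE conjcK.
  rewrite /w; under eq_bigr do rewrite row_mxEl mxE.
  by rewrite al10 mul0r.
have S0 : 0 <= \sum_k (\sum_a e k a 0 * al a) * (\sum_a e k a 0 * al a)^*%C.
  by apply: sumr_ge0 => k _; exact: mulcJ_ge0.
rewrite /conorm SE sqr_sqrtr ?RRe_real ?ger0_real//.
by move: S0; rewrite lecE/= => /andP[].
Qed.

End Hermitian.

(** * Degrees and dimensions admitting a complex vector cross product *)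

Section HermitianProduct.
Variables (R : realType) (n : nat).
Local Notation C := R[i].

Definition inner (A B : 'I_n -> C) : C := \sum_k A k * (B k)^*%C.

Lemma inner_ge0 A : 0 <= inner A A.
Proof. by apply: sumr_ge0 => k _; exact: mulcJ_ge0. Qed.

Definition phase (z : C) : Prop := z * z^*%C = 1.

Lemma phase1 : phase 1.
Proof. by rewrite /phase conjc1 mulr1. Qed.

Lemma phase_i : phase 'i%C.
Proof. by rewrite /phase conjc_i mulrN mulii opprK. Qed.

Lemma phaseN z : phase z -> phase (- z).
Proof. by rewrite /phase conjcN mulrNN. Qed.

(** A Laurent polynomial in [z] of degree at most one that vanishes at the fourth
    roots of unity is zero; this is how values on unit vectors are polarised. *)
Lemma four_phases (p X Y : C) :
  (forall z, phase z -> p + z^*%C * X + z * Y = 0) -> X = 0.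
Proof.
move=> H.
have := H _ phase1; have := H _ (phaseN phase1).
have := H _ phase_i; have := H _ (phaseN phase_i).
rewrite !conjcN conjc1 conjc_i => e4 e3 e2 e1.
have E : 4 * X = (p + 1 * X + 1 * Y) - (p + - 1 * X + - 1 * Y)
  + 'i%C * ((p + - 'i%C * X + 'i%C * Y) - (p + - - 'i%C * X + - 'i%C * Y)).
  have := mulii R; move: 'i%C => j jj.
  transitivity (2 * X - 2 * (j * j) * X + 2 * Y + 2 * (j * j) * Y); last by ring.
  by rewrite jj; ring.
move: E; rewrite e1 e2 e3 e4 subrr mulr0 addr0 => /eqP.
by rewrite mulf_eq0 pnatr_eq0 => /eqP.
Qed.

Definition isqrt2 : C := ((Num.sqrt 2)^-1)%:C%C.

Lemma isqrt2_conj : isqrt2^*%C = isqrt2.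
Proof. exact: conjc_real. Qed.

Lemma isqrt2_sqr : 2 * (isqrt2 * isqrt2) = 1.
Proof.
rewrite /isqrt2 -rmorphM -invfM -expr2 sqr_sqrtr// -(rmorph_nat (real_complex R)).
by rewrite -rmorphM divff ?rmorph1// pnatr_eq0.
Qed.

Lemma inner_phase (X Y A B A' B' : 'I_n -> C) z : phase z ->
  (forall k, X k = isqrt2 * (A k + z * B k)) ->
  (forall k, Y k = isqrt2 * (A' k + z * B' k)) ->
  2 * inner X Y = inner A A' + inner B B' + z^*%C * inner A B' + z * inner B A'.
Proof.
move=> zz XE YE; rewrite /inner !mulr_sumr -!big_split; apply: eq_bigr => k _ /=.
rewrite XE YE !(conjcM, conjcD) isqrt2_conj.
transitivity ((2 * (isqrt2 * isqrt2)) * (A k * (A' k)^*%C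
  + (z * z^*%C) * (B k * (B' k)^*%C) + z^*%C * (A k * (B' k)^*%C)
  + z * (B k * (A' k)^*%C))); first by ring.
by rewrite isqrt2_sqr zz !mul1r.
Qed.

End HermitianProduct.

Section CrossProduct.
Variables (R : realType) (n r : nat).
Local Notation d := (n + n)%N.
Local Notation C := R[i].
Local Notation VC := 'cV[C]_d.
Local Notation J := (@stdJ R n).
Variable G : 'M[R]_d.
Hypothesis symG : G^T = G.
Hypothesis posG : forall v : 'cV[R]_d, v != 0 -> 0 < bilf G v v.
Hypothesis hermG : J^T *m G *m J = G.
Variables (f : ('I_r.+1 -> VC) -> C) (fP : form_at f) (c : R).

Definition orthonormal m (e : 'I_m -> VC) : Prop :=
  (forall i, T10 (e i)) /\ forall i j, herm G (e i) (e j) = (i == j)%:R.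

Hypothesis cross : forall e : 'I_r -> VC, orthonormal e ->
  conorm G (fun k => f (rcons_vec e (cplx_mx (basis_vec R k)))) ^+ 2 = c.
Variables (E : 'I_n -> VC) (Eo : orthonormal E).

(** The contraction of the form with [e], as the vector of its values on the
    unitary frame [E]. *)
Definition slice (e : 'I_r -> VC) (k : 'I_n) : C := f (rcons_vec e (E k)).

Implicit Types (e : 'I_r -> VC) (s t : 'I_r).

Lemma conj_T10 (v : VC) : T10 v -> T01 (map_mx conjc v).
Proof.
rewrite /T10 /T01 => Tv; rewrite -[cplx_mx J]conj_cplx -conj_mxM Tv.
by apply/matrixP => i j; rewrite !mxE conjcM conjc_i.
Qed.

Lemma slice_norm e : orthonormal e -> inner (slice e) (slice e) = c%:C%C.
Proof.
move=> eo; rewrite -(cross eo).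
rewrite (conorm_frame posG hermG Eo.1 Eo.2) => [|k].
  by apply: eq_bigr => k _; rewrite /slice rcons_coord.
transitivity (f (rcons_vec e (map_mx conjc (E k)))).
  by rewrite rcons_coord//; apply: eq_bigr => a _; rewrite mxE.
have [_ _ T] := fP; apply: (T _ ord_max); rewrite rcons_vec_max.
by apply: conj_T10; exact: Eo.1.
Qed.

Lemma slice_comb e s x u v z k :
  slice (dfwith e s (x *: (u + z *: v))) k
  = x * (slice (dfwith e s u) k + z * slice (dfwith e s v) k).
Proof. by rewrite /slice !rcons_vec_dfwith (kformZ fP) (kformD fP) (kformZ fP). Qed.

Lemma orthonormal_dfwith e s b : orthonormal e -> T10 b -> herm G b b = 1 ->
  (forall i, i != s -> herm G b (e i) = 0) -> orthonormal (dfwith e s b).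
Proof.
move=> [Te He] Tb bb be; split=> [i|i j]; first by case: dfwithP.
case: (dfwithP e b i) => [|i' si']; case: (dfwithP e b j) => [|j' sj'].
- by rewrite eqxx.
- by rewrite be ?(negPf sj')// eq_sym.
- have i's : i' != s by rewrite eq_sym.
  by rewrite -herm_conj// be// conjc0 (negPf i's).
- exact: He.
Qed.

Lemma T10D (u v : VC) : T10 u -> T10 v -> T10 (u + v).
Proof. by rewrite /T10 mulmxDr => -> ->; rewrite scalerDr. Qed.

(** Replacing a member of the frame by its normalised sum with a multiple of a new
    unit vector keeps the frame orthonormal. *)
Lemma orthonormal_phase e s b z : orthonormal e -> T10 b -> herm G b b = 1 ->
  (forall i, herm G b (e i) = 0) -> phase z ->
  orthonormal (dfwith e s (isqrt2 R *: (e s + z *: b))).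
Proof.
move=> eo Tb bb be zz; have [Te He] := eo.
have eb i : herm G (e i) b = 0 by rewrite -herm_conj// be conjc0.
apply: orthonormal_dfwith => //.
- by apply: T10Z; apply: T10D => //; exact: T10Z.
- rewrite hermZl hermZr// !(hermDl, hermDr)// !(hermZl, hermZr)//.
  rewrite be eb bb He eqxx isqrt2_conj !mulr0 addr0 add0r mulr1 zz mulrA.
  by rewrite -[1 + 1]/(2%:R) mulrC isqrt2_sqr.
- by move=> i si; rewrite hermZl hermDl hermZl He be mulr0 addr0 eq_sym (negPf si) mulr0.
Qed.

(** The norm of the slice is constant when the argument of index [s] runs over the
    normalised sums of [e s] and a multiple of [b] by a phase. *)
Lemma slice_orth1 e s b : orthonormal e -> T10 b -> herm G b b = 1 ->
  (forall i, herm G b (e i) = 0) -> inner (slice e) (slice (dfwith e s b)) = 0.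
Proof.
move=> eo Tb bb be.
apply: (@four_phases _ (inner (slice e) (slice e)
    + inner (slice (dfwith e s b)) (slice (dfwith e s b)) - 2 * c%:C%C)
  _ (inner (slice (dfwith e s b)) (slice e))) => z zz.
have XE k := slice_comb e s (isqrt2 R) (e s) b z k.
rewrite dfwith_id in XE.
have := inner_phase zz XE XE; rewrite slice_norm; last exact: orthonormal_phase.
move=> ->; ring.
Qed.

(** The orthogonality of slices that differ in one argument is in turn polarised
    in a second argument. *)
Lemma slice_orth2 e s t a b : orthonormal e -> s != t ->
  T10 a -> herm G a a = 1 -> (forall i, herm G a (e i) = 0) ->
  T10 b -> herm G b b = 1 -> (forall i, herm G b (e i) = 0) ->
  herm G b a = 0 ->
  inner (slice e) (slice (dfwith (dfwith e s b) t a)) = 0.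
Proof.
move=> eo st Ta aa ae Tb bb be ba.
pose B := slice (dfwith e s b).
apply: (@four_phases _ (inner (slice e) B + inner (slice (dfwith e t a))
     (slice (dfwith (dfwith e s b) t a))) _ (inner (slice (dfwith e t a)) B)) => z zz.
have XE k := slice_comb e t (isqrt2 R) (e t) a z k.
rewrite dfwith_id in XE.
have Bt : dfwith (dfwith e s b) t (e t) = dfwith e s b.
  by rewrite -{2}(dfwith_id (dfwith e s b) t) dfwithout.
have YE k : slice (dfwith (dfwith e t (isqrt2 R *: (e t + z *: a))) s b) k
    = isqrt2 R * (B k + z * slice (dfwith (dfwith e s b) t a) k).
  by rewrite -(dfwith_swap _ _ _ st) slice_comb Bt.
have := inner_phase zz XE YE; rewrite slice_orth1//.
- by rewrite mulr0 => /esym E0; rewrite -[RHS]E0 -/B; ring.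
- exact: orthonormal_phase.
move=> i; case: dfwithP => [|i' _]; last exact: be.
by rewrite hermZr// hermDr// hermZr// be ba !mulr0 addr0 mulr0.
Qed.

(** If [r = n], an orthonormal [e] exhausts the frame, so one more argument from
    the frame repeats a member of [e] and the slice is zero. *)
Lemma cross_degree_neq : c != 0 -> (r <= n)%N -> r != n.
Proof.
move=> c0 rn; apply: contraNneq c0 => E0.
have eo : orthonormal (fun i : 'I_r => E (widen_ord rn i)).
  by split=> [i|i j]; [exact: Eo.1 | exact: Eo.2].
have := slice_norm eo; rewrite /inner big1 => [/esym/complexI ->//|k _].
have kr : (k < r)%N by rewrite E0.
have [_ alt _] := fP; rewrite /slice (alt _ (lift ord_max (Ordinal kr)) ord_max) ?mul0r//.
  by rewrite eq_sym neq_lift.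
rewrite rcons_vec_max rcons_vec_lift; congr (E _); exact: val_inj.
Qed.

End CrossProduct.

Section TwoFreeArguments.
Variables (R : realType) (n q : nat).
Local Notation r := q.+2.
Local Notation d := (n + n)%N.
Local Notation C := R[i].
Local Notation VC := 'cV[C]_d.
Local Notation J := (@stdJ R n).
Variable G : 'M[R]_d.
Hypothesis symG : G^T = G.
Hypothesis posG : forall v : 'cV[R]_d, v != 0 -> 0 < bilf G v v.
Hypothesis hermG : J^T *m G *m J = G.
Variables (f : ('I_r.+1 -> VC) -> C) (fP : form_at f) (c : R) (c0 : 0 < c).
Hypothesis cross : forall e : 'I_r -> VC, orthonormal G e ->
  conorm G (fun k => f (rcons_vec e (cplx_mx (basis_vec R k)))) ^+ 2 = c.
Variables (E : 'I_n -> VC) (Eo : orthonormal G E).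
Hypothesis rn : (r.+2 <= n)%N.

Let rn' : (r <= n)%N. Proof. exact: leq_trans (leqW (leqnSn _)) rn. Qed.

Local Notation s0 := (ord0 : 'I_r).
Local Notation s1 := (lift ord0 ord0 : 'I_r).

(** All arguments but two are frozen to members of the frame; the free indices
    are those of the other members, of which there are at least four. *)
Let free (i : 'I_n) := (i < 2)%N || (r <= i)%N.
Let sel (i j : 'I_n) : 'I_r -> 'I_n := dfwith (dfwith (widen_ord rn') s0 i) s1 j.
Let T (i j : 'I_n) : 'I_n -> C := slice f E (E \o sel i j).

Let E_dfwith (g : 'I_r -> 'I_n) s i : E \o dfwith g s i = dfwith (E \o g) s (E i).
Proof.
apply/funext => t /=; have [<-|st] := eqVneq s t; first by rewrite !dfwithin.
by rewrite !dfwithout.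
Qed.

Let s01 : s0 != s1. Proof. by []. Qed.

Let sel0 i j : sel i j s0 = i.
Proof. by rewrite /sel dfwithout ?dfwithin// eq_sym. Qed.

Let sel1 i j : sel i j s1 = j.
Proof. by rewrite /sel dfwithin. Qed.

Let sel_gt1 i j (s : 'I_r) : (1 < s)%N -> sel i j s = widen_ord rn' s.
Proof.
move=> s1'; rewrite /sel !dfwithout//.
  by apply/eqP => /(congr1 val) /= E0; rewrite -E0 in s1'.
by apply/eqP => /(congr1 val) /= E0; rewrite -E0 in s1'.
Qed.

Let ordP (s : 'I_r) : [\/ s = s0, s = s1 | (1 < s)%N].
Proof.
case: s => [[|[|s]] sr]; first by apply: Or31; exact: val_inj.
  by apply: Or32; exact: val_inj.
exact: Or33.
Qed.

Let free_widen (s : 'I_r) : (1 < s)%N -> ~~ free (widen_ord rn' s).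
Proof. by move=> gt1; rewrite /free /= negb_or -leqNgt gt1 -ltnNge ltn_ord. Qed.

Let sel_neq i j b s : free b -> i != b -> j != b -> sel i j s != b.
Proof.
move=> fb ib jb; case: (ordP s) => [->|->|gt1]; rewrite ?sel0 ?sel1//.
by rewrite sel_gt1//; apply: contraTneq fb => <-; exact: free_widen.
Qed.

Let sel_inj i j : free i -> free j -> i != j -> injective (sel i j).
Proof.
move=> fi fj ij s t; case: (ordP s) => [->|->|gs]; case: (ordP t) => [->|->|gt];
  rewrite ?sel0 ?sel1 ?sel_gt1// => E0; try by move: ij; rewrite E0 eqxx.
- by move: (free_widen gt); rewrite -E0 fi.
- by move: (free_widen gt); rewrite -E0 fj.
- by move: (free_widen gs); rewrite E0 fi.
- by move: (free_widen gs); rewrite E0 fj.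
- by apply: val_inj; move/(congr1 val): E0.
Qed.

Let frame_sel g : injective g -> orthonormal G (E \o g : 'I_r -> VC).
Proof.
move=> gi; split=> [s|s t]; first exact: Eo.1.
by rewrite /= Eo.2 (inj_eq gi).
Qed.

Let T_swap i j k : T i j k = - T j i k.
Proof.
rewrite /T /sel !E_dfwith /slice !rcons_vec_dfwith.
by apply: (kform_swap fP).
Qed.

Let T_last i j k : T i j k = - T i k j.
Proof.
rewrite /T /sel !E_dfwith /slice.
rewrite (rcons_vecE _ (E k) 0) (rcons_vecE _ (E j) 0) !rcons_vec_dfwith.
by apply: (kform_swap fP); rewrite eq_sym neq_lift.
Qed.

Let T_diag i k : T i i k = 0.
Proof.
have /eqP := T_swap i i k; rewrite -subr_eq0 opprK -mulr2n -mulr_natl mulf_eq0.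
by rewrite pnatr_eq0 => /eqP.
Qed.

Let T_frozen i j k : ~~ (free i && free j) -> T i j k = 0.
Proof.
have H l m : ~~ free l -> T l m k = 0.
  rewrite /free negb_or -leqNgt -ltnNge => /andP[l1 lr].
  have [_ alt _] := fP.
  apply: (alt _ (lift ord_max s0) (lift ord_max (Ordinal lr))).
    by rewrite (inj_eq lift_inj); apply/eqP => /(congr1 val) /= E0; rewrite -E0 in l1.
  rewrite !rcons_vec_lift /= sel0 sel_gt1//; congr (E _); exact: val_inj.
by rewrite negb_and => /orP[/H//|/H E0]; rewrite T_swap E0 oppr0.
Qed.

(** The four cases of equality of [(i, j)] and [(l, m)] are the norm condition, its
    polarisation in either argument, and its polarisation in both. *)
Let gram_aligned i j l m : free i -> free j -> free l -> free m ->
  i != j -> l != m -> i != m -> j != l ->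
  inner (T i j) (T l m) = c%:C%C * ((i == l)%:R * (j == m)%:R).
Proof.
move=> fi fj fl fm ij lm im jl.
have eo : orthonormal G (E \o sel i j) by apply: frame_sel; exact: sel_inj.
have EE b : herm G (E b) (E b) = 1 by rewrite Eo.2 eqxx.
have Eb b s : free b -> i != b -> j != b -> herm G (E b) ((E \o sel i j) s) = 0.
  by move=> fb ib jb; rewrite /= Eo.2 eq_sym (negPf (sel_neq _ _ _ _)).
have [il|il] := eqVneq i l; have [jm|jm] := eqVneq j m.
- rewrite -il -jm mulr1 mulr1 /T.
  exact: (slice_norm posG hermG fP cross Eo).
- rewrite mulr0 mulr0 -il /T.
  have -> : E \o sel i m = dfwith (E \o sel i j) s1 (E m).
    by rewrite -E_dfwith /sel dfwith_dfwith.
  apply: (slice_orth1 symG posG hermG fP cross Eo) => //; first exact: Eo.1.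
  by move=> s; exact: Eb.
- rewrite mul0r mulr0 -jm /T.
  have -> : E \o sel l j = dfwith (E \o sel i j) s0 (E l).
    by rewrite -E_dfwith /sel -(dfwith_swap _ _ _ s01) dfwith_dfwith.
  apply: (slice_orth1 symG posG hermG fP cross Eo) => //; first exact: Eo.1.
  by move=> s; exact: Eb.
- rewrite mul0r mulr0 /T.
  have -> : E \o sel l m = dfwith (dfwith (E \o sel i j) s0 (E l)) s1 (E m).
    by rewrite -!E_dfwith /sel -(dfwith_swap _ _ _ s01) !dfwith_dfwith.
  apply: (slice_orth2 symG posG hermG fP cross Eo) => //; try exact: Eo.1.
  + by move=> s; exact: Eb.
  + by move=> s; exact: Eb.
  + by rewrite Eo.2 (negPf lm).
Qed.

Let gram i j l m : inner (T i j) (T l m) = c%:C%C * (free i && free j)%:R *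
  ((i == l)%:R * (j == m)%:R - (i == m)%:R * (j == l)%:R).
Proof.
have [/andP[fi fj]|nf] := boolP (free i && free j); last first.
  by rewrite mulr0 mul0r /inner big1// => k _; rewrite T_frozen ?mul0r.
rewrite mulr1; have [ij|ij] := eqVneq i j.
  rewrite -ij /inner big1 => [|k _]; last by rewrite T_diag mul0r.
  ring.
have [lm|lm] := eqVneq l m.
  rewrite -lm /inner big1 => [|k _]; last by rewrite T_diag conjc0 mulr0.
  ring.
have [/andP[fl fm]|nf] := boolP (free l && free m); last first.
  rewrite /inner big1 => [|k _]; last by rewrite [T l m k]T_frozen ?conjc0 ?mulr0.
  have neq a b : free a -> ~~ free b -> (a == b) = false.
    by move=> fa fb; apply: contraNF fb => /eqP <-.
  by move: nf; rewrite negb_and => /orP[nf|nf];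
    rewrite !(neq _ _ _ nf)//= !(mulr0, mul0r) subrr mulr0.
have NT : inner (T i j) (T l m) = - inner (T i j) (T m l).
  by rewrite /inner -sumrN; apply: eq_bigr => k _; rewrite [T l m k]T_swap conjcN mulrN.
have [im|im] := eqVneq i m.
  have il : i != l by rewrite im eq_sym.
  have jm : j != m by rewrite -im eq_sym.
  by rewrite NT gram_aligned// 1?[m == l]eq_sym// (negPf il) im eqxx mul1r mul0r sub0r mulrN.
have [jl|jl] := eqVneq j l.
  have il : i != l by rewrite -jl.
  have jm : j != m by rewrite jl.
  by rewrite NT gram_aligned// 1?[m == l]eq_sym// (negPf il) (negPf im) !mul0r subrr mulr0 oppr0.
by rewrite gram_aligned// mul0r subr0.
Qed.

(** The Gram matrix of the columns of the tensor [T]. *)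
Let M (p k : 'I_n) : C := \sum_l \sum_m (T l m p)^*%C * T l m k.

Let MT i j p : \sum_k T i j k * M k p = 2 * c%:C%C * T i j p.
Proof.
transitivity (\sum_l \sum_m inner (T i j) (T l m) * T l m p).
  under eq_bigr do rewrite mulr_sumr.
  rewrite exchange_big/=; apply: eq_bigr => l _.
  under eq_bigr do rewrite mulr_sumr.
  rewrite exchange_big/=; apply: eq_bigr => m _.
  by rewrite mulr_suml; apply: eq_bigr => k _; rewrite mulrA.
under eq_bigr do under eq_bigr do rewrite gram.
have [fij|nf] := boolP (free i && free j); last first.
  rewrite [T i j p]T_frozen ?nf// [RHS]mulr0 big1// => l _; rewrite big1// => m _.
  by rewrite mulr0 !mul0r.
have S (a b : 'I_n) : \sum_l \sum_m (a == l)%:R * (b == m)%:R * T l m p = T a b p.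
  rewrite (bigD1 a)//= (bigD1 b)//= !eqxx !mul1r !big1 ?addr0// => [l|m] la.
    by rewrite big1// => m _; rewrite eq_sym (negPf la) !mul0r.
  by rewrite [b == _]eq_sym (negPf la) mulr0 mul0r.
transitivity (c%:C%C * (T i j p - T j i p)); last by rewrite [T j i p]T_swap; ring.
rewrite -(S i j) -(S j i) -sumrB mulr_sumr; apply: eq_bigr => l _.
rewrite -sumrB mulr_sumr; apply: eq_bigr => m _.
rewrite mulr1; ring.
Qed.

(** The rows [T i j] of [T] are orthogonal with equal norms, each counted twice by
    antisymmetry, so [M * M] is [2 * c] times [M] and the diagonal of [M] is at most
    [2 * c].  By antisymmetry a diagonal entry is also the sum of the squared norms
    of the rows [T p l], of which at least three are nonzero when there are four
    free indices. *)
Lemma no_cross_product : False.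
Proof.
have n0 : (0 < n)%N by exact: leq_trans rn.
pose p : 'I_n := Ordinal n0.
have Mconj k : (M p k)^*%C = M k p.
  rewrite /M conjc_sum; apply: eq_bigr => l _.
  rewrite conjc_sum; apply: eq_bigr => m _.
  by rewrite conjcM conjcK mulrC.
have MM : \sum_k M p k * M k p = 2 * c%:C%C * M p p.
  rewrite {1 3}/M; under eq_bigr do rewrite mulr_suml.
  rewrite exchange_big mulr_sumr; apply: eq_bigr => l _ /=.
  under eq_bigr do rewrite mulr_suml.
  rewrite exchange_big mulr_sumr; apply: eq_bigr => m _ /=.
  under eq_bigr do rewrite -mulrA.
  by rewrite -mulr_sumr MT mulrCA.
have Mp : M p p = \sum_l inner (T p l) (T p l).
  rewrite /M; apply: eq_bigr => l _; apply: eq_bigr => m _.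
  have -> : T l m p = T p l m by rewrite T_last T_swap opprK.
  by rewrite mulrC.
have c1 : 0 < c%:C%C :> C by rewrite -[0]/((0 : R)%:C%C) ltcR.
have pl l : free l -> l != p -> inner (T p l) (T p l) = c%:C%C.
  move=> fl lp; have fp : free p by [].
  by rewrite gram !eqxx (negPf lp) fp fl !mulr1 mulr0 subr0 mulr1.
have r1 : (1 < n)%N by exact: leq_trans rn.
have rn0 : (r < n)%N by exact: leq_trans rn.
pose a1 : 'I_n := Ordinal r1; pose a2 : 'I_n := Ordinal rn0; pose a3 : 'I_n := Ordinal rn.
have M3 : 3 * c%:C%C <= M p p.
  have a32 : a3 != a2 by rewrite -val_eqE /= neq_ltn ltnSn orbT.
  rewrite Mp (bigD1 a1)// (bigD1 a2)// (bigD1 a3)/=; last by rewrite a32.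
  have f2 : free a2 by apply/orP; right; exact: leqnn.
  have f3 : free a3 by apply/orP; right; exact: leqnSn.
  rewrite (pl a1)// (pl a2)// (pl a3)//.
  have -> : 3 * c%:C%C = c%:C%C + (c%:C%C + (c%:C%C + 0)) :> C by ring.
  by rewrite !lerD2l; apply: sumr_ge0 => l _; exact: inner_ge0.
have M0 : 0 < M p p by apply: lt_le_trans M3; rewrite mulr_gt0.
have : M p p * M p p <= 2 * c%:C%C * M p p.
  rewrite -MM (bigD1 p)//= lerDl; apply: sumr_ge0 => k _.
  by rewrite -Mconj mulcJ_ge0.
rewrite ler_pM2r// => M2; have := le_trans M3 M2.
by rewrite ler_pM2r// ler_nat.
Qed.

End TwoFreeArguments.

(** * The case of two-forms: quaternionic algebra *)

Section Quaternionic.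
Variables (R : realType) (n : nat).
Local Notation d := (n + n)%N.
Local Notation J := (@stdJ R n).
Variables (G Phi : 'M[R]_d).
Hypothesis symG : G^T = G.
Hypothesis posG : forall v : 'cV[R]_d, v != 0 -> 0 < bilf G v v.
Hypothesis hermG : J^T *m G *m J = G.
Hypothesis antiPhi : Phi^T = - Phi.
Hypothesis PhiJ : J^T *m Phi = Phi *m J.
Hypothesis isoPhi : forall a, bilf G a a = 1 ->
  bilf (Phi *m invmx G *m Phi^T) a a = 1.

Let uG : G \in unitmx. Proof. exact: posdef_unitmx. Qed.

Lemma invG_sym : (invmx G)^T = invmx G.
Proof. by rewrite trmx_inv symG. Qed.

Lemma J_inj m (A B : 'M[R]_(m, d)) : A *m J = B *m J -> A = B.
Proof.
move=> /(congr1 (fun N => N *m J)); rewrite -!mulmxA stdJ_sqr !mulmxN !mulmx1.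
exact: oppr_inj.
Qed.

Lemma invG_J : invmx G *m J^T = - J *m invmx G.
Proof.
have E : G *m J = - J^T *m G.
  by rewrite -{2}hermG stdJ_tr !mulNmx opprK mulmxN !mulmxA stdJ_sqr !mulNmx mul1mx opprK.
rewrite -[LHS]mulmx1 -(mulmxV uG) !mulmxA; congr (_ *m _).
by rewrite -!mulmxA -[J^T *m G]opprK -mulNmx -E mulmxN mulKmx.
Qed.

(** Unit vectors suffice by homogeneity, and both sides are symmetric. *)
Lemma iso_polar : Phi *m invmx G *m Phi^T = G.
Proof.
set S := (X in X = _).
have Ssym : S^T = S by rewrite /S !trmx_mul trmxK invG_sym mulmxA.
have diag a : bilf S a a = bilf G a a.
  have [->|a0] := eqVneq a 0; first by rewrite /bilf !mulmx0 !mxE.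
  have ga := posG a0.
  pose s := (Num.sqrt (bilf G a a))^-1.
  have bs X : bilf X (s *: a) (s *: a) = s ^+ 2 * bilf X a a.
    have -> : bilf X (s *: a) (s *: a) = ((s *: a^T) *m X *m (s *: a)) 0 0.
      by rewrite /bilf [X in X *m _ *m _]linearZ.
    by rewrite -scalemxAr -!scalemxAl 2!mxE expr2 mulrA.
  have s2 : s ^+ 2 * bilf G a a = 1.
    by rewrite exprVn sqr_sqrtr ?(ltW ga)// mulVf ?gt_eqF.
  have := isoPhi (etrans (bs G) s2); rewrite bs -s2 => /mulfI; apply.
  by rewrite expf_neq0// invr_neq0// sqrtr_eq0 -ltNge.
have bD X (u v : 'cV[R]_d) : X^T = X ->
    bilf X (u + v) (u + v) = bilf X u u + bilf X v v + 2 * bilf X u v.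
  move=> Xs; have : bilf X v u = bilf X u v by rewrite -bilf_tr Xs.
  have tD : (u + v)^T = u^T + v^T by rewrite linearD.
  rewrite /bilf tD !mulmxDl !mulmxDr; move: (u^T *m X *m u) (v^T *m X *m v).
  have aE (P Q : 'M[R]_1) : (P + Q) 0 0 = P 0 0 + Q 0 0 by rewrite mxE.
  by move=> Y Z E; rewrite !aE E; ring.
apply: bilf_ext => u v; have := diag (u + v); rewrite !bD// !diag.
by move=> /addrI/mulfI; apply; rewrite pnatr_eq0.
Qed.

(** The endomorphism X with g(X u, v) = Phi(u, v). *)
Definition sharp_mx : 'M[R]_d := - (invmx G *m Phi).

Lemma mul_sharp : G *m sharp_mx = - Phi.
Proof. by rewrite /sharp_mx mulmxN mulKVmx. Qed.

Lemma sharp_sqr : sharp_mx *m sharp_mx = - 1%:M.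
Proof.
rewrite /sharp_mx mulNmx mulmxN opprK -mulmxA.
have := iso_polar; rewrite antiPhi mulmxN => /(congr1 (fun N => - N)).
by rewrite opprK -mulmxA => ->; rewrite mulmxN mulVmx.
Qed.

Lemma sharp_J : sharp_mx *m J = - (J *m sharp_mx).
Proof.
rewrite /sharp_mx mulmxN mulNmx opprK -mulmxA -PhiJ mulmxA invG_J.
by rewrite !mulNmx opprK mulmxA.
Qed.

Lemma sharp_herm : sharp_mx^T *m G *m sharp_mx = G.
Proof.
rewrite -mulmxA mul_sharp /sharp_mx -mulmxN -antiPhi trmx_mul invG_sym trmxK.
exact: iso_polar.
Qed.

Lemma Phi_unit : Phi \in unitmx.
Proof.
have : G \in unitmx by [].
by rewrite -iso_polar !unitmx_mul unitmx_tr => /andP[/andP[]].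
Qed.

(** [Phi] consists of the blocks A, B, B, -A for a complex skew matrix A + iB, which
    in odd size would be singular; a kernel vector x + iy of it gives the kernel
    vector (x, -y) of [Phi]. *)
Lemma quaternionic_even : ~~ odd n.
Proof.
apply/negP => on.
pose A := ulsubmx Phi; pose B := ursubmx Phi.
have [PD PC] : drsubmx Phi = - A /\ dlsubmx Phi = B.
  have E : - (J *m block_mx A B (dlsubmx Phi) (drsubmx Phi))
      = block_mx A B (dlsubmx Phi) (drsubmx Phi) *m J.
    by rewrite submxK -PhiJ stdJ_tr mulNmx.
  move: E; rewrite /stdJ !mulmx_block !mul0mx !mulmx0 !mul1mx !mulmx1 !mulNmx.
  rewrite !mulmxN !mul1mx !mulmx1 !add0r !addr0 opp_block_mx !opprK.
  by case/eq_block_mx => -> -> _ _.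
have PhiE : Phi = block_mx A B B (- A) by rewrite -PD -{2}PC submxK.
have [At Bt] : A^T = - A /\ B^T = - B.
  move: antiPhi; rewrite PhiE tr_block_mx opp_block_mx.
  by case/eq_block_mx.
pose Z : 'M[R[i]]_n := cplx_mx A + 'i%C *: cplx_mx B.
have Zt : Z^T = - Z.
  by rewrite /Z linearD linearZ/= !cplx_tr At Bt !cplx_mxN scalerN opprD.
have : \det Z == 0.
  have : \det Z = - \det Z.
    rewrite -{1}det_tr Zt -scaleN1r detZ -signr_odd on expr1 mulN1r //.
  by move/eqP; rewrite -subr_eq0 opprK -mulr2n mulrn_eq0.
case/det0P => v v0 vZ.
pose x := map_mx (@complex.Re R) v; pose y := map_mx (@complex.Im R) v.
have vE : v = cplx_mx x + 'i%C *: cplx_mx y by exact: ReIm_mx.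
have E : cplx_mx (x *m A - y *m B) + 'i%C *: cplx_mx (x *m B + y *m A) = 0.
  rewrite -vZ vE /Z mulmxDl !mulmxDr -!scalemxAl -!scalemxAr !scalerA mulii scaleN1r.
  rewrite !cplx_mxD cplx_mxN !cplx_mxM scalerDr.
  rewrite -!addrA; congr (_ + _); rewrite addrCA; congr (_ + _).
  by rewrite addrC.
have ReIm0 (p q : 'rV[R]_n) : cplx_mx p + 'i%C *: cplx_mx q = 0 -> p = 0 /\ q = 0.
  move=> pq; split; apply/rowP => j; have := congr1 (fun N : 'rV_n => N 0 j) pq.
    by rewrite !mxE => /(congr1 (@complex.Re R)) /= H; lra.
  by rewrite !mxE => /(congr1 (@complex.Im R)) /= H; lra.
have [E1 E2] := ReIm0 _ _ E.
have : row_mx x (- y) *m Phi = 0.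
  rewrite PhiE mul_row_block !mulNmx mulmxN opprK E1 E2.
  by rewrite row_mx0.
move/(congr1 (fun N => N *m invmx Phi)); rewrite mulmxK ?Phi_unit// mul0mx.
rewrite -row_mx0 => /eq_row_mx[x0 /eqP]; rewrite oppr_eq0 => /eqP y0.
by move: v0; rewrite vE x0 y0 /cplx_mx !map_mx0 scaler0 addr0 eqxx.
Qed.

End Quaternionic.

(** [N] stands for the covariant derivative of [X] along [w] and [NJ] for that along
    [J w].  Both anticommute with [X]; as [J] does too, for [NJ = N *m J] this says
    that [N] commutes with [X].  Hence [N *m X] is zero, and [X] is invertible. *)
Lemma parallel_of_quaternionic (R : realType) n (X N NJ : 'M[R]_(n + n)) :
  X *m X = - 1%:M -> X *m stdJ R n = - (stdJ R n *m X) ->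
  N *m X + X *m N = 0 -> NJ *m X + X *m NJ = 0 -> NJ = N *m stdJ R n ->
  N = 0.
Proof.
set J := stdJ R n => XX XJ NX NJX NJE.
have XN : X *m N = N *m X.
  apply: J_inj; apply/eqP; rewrite -subr_eq0 -mulmxA -/J -[N *m X *m J]mulmxA XJ.
  rewrite mulmxN opprK -NJE mulmxA -NJE addrC; apply/eqP; exact: NJX.
have : X *m (N *m X) = 0.
  by rewrite mulmxA XN; move: NX; rewrite XN -mulr2n => /eqP; rewrite -scaler_nat scaler_eq0
    pnatr_eq0/= => /eqP ->; rewrite mul0mx.
move/(congr1 (fun Y => X *m Y)); rewrite mulmx0 mulmxA XX mulNmx mul1mx.
move/(congr1 (fun Y => Y *m X)); rewrite mul0mx mulNmx -mulmxA XX mulmxN mulmx1.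
by rewrite opprK.
Qed.

Section TwoForm.
Variables (R : realType) (n : nat).
Local Notation d := (n + n)%N.
Local Notation VC := 'cV[R[i]]_d.
Local Notation J := (@stdJ R n).
Local Notation JC := (cplx_mx J).

Definition pairing (f : ('I_2 -> VC) -> R[i]) (u w : VC) : R[i] :=
  f (rcons_vec (fun _ : 'I_1 => u) w).

(** The matrix of the real part of the two-form on real tangent vectors. *)
Definition re_form_mx (f : ('I_2 -> VC) -> R[i]) : 'M[R]_d :=
  \matrix_(i, j) complex.Re (pairing f (cplx_mx (basis_vec R i)) (cplx_mx (basis_vec R j))).

Variables (f : ('I_2 -> VC) -> R[i]) (fP : form_at f).

Implicit Types (u w : VC).

Lemma pairingE u w (v0 : 'I_2 -> VC) : rcons_vec (fun _ : 'I_1 => u) w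
  = dfwith (dfwith v0 (lift ord_max ord0) u) ord_max w.
Proof.
apply/funext => k; case: (unliftP ord_max k) => [i ->|->].
  rewrite rcons_vec_lift dfwithout ?neq_lift//.
  by rewrite (ord1 i) dfwithin.
by rewrite rcons_vec_max dfwithin.
Qed.

Lemma pairing_swap u w : pairing f u w = - pairing f w u.
Proof.
rewrite /pairing (pairingE u w (fun=> 0)) (pairingE w u (fun=> 0)).
by apply: (kform_swap fP); rewrite eq_sym neq_lift.
Qed.

Lemma pairing_J u w : pairing f u (JC *m w) = 'i%C * pairing f u w.
Proof. by rewrite /pairing !(pairingE _ _ (fun=> 0)) (kform_J fP). Qed.

Lemma pairing_Jl u w : pairing f (JC *m u) w = 'i%C * pairing f u w.
Proof. by rewrite pairing_swap pairing_J [pairing f w u]pairing_swap mulrN opprK. Qed.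

Lemma pairingBr u u' w c : pairing f w (u - c *: u') = pairing f w u - c * pairing f w u'.
Proof. by rewrite /pairing !(pairingE _ _ (fun=> 0)) (kformB fP) (kformZ fP). Qed.

Lemma pairingBl u u' w c : pairing f (u - c *: u') w = pairing f u w - c * pairing f u' w.
Proof.
rewrite pairing_swap pairingBr [pairing f w u]pairing_swap.
rewrite [pairing f w u']pairing_swap; ring.
Qed.

Lemma pairingZl u w c : pairing f (c *: u) w = c * pairing f u w.
Proof.
have := pairingBl 0 u w (- c); rewrite sub0r scaleNr opprK => ->.
have -> : pairing f 0 w = 0.
  by rewrite pairing_swap /pairing (pairingE _ _ (fun=> 0)) (kform0 fP) oppr0.
by rewrite sub0r mulNr opprK.
Qed.

Lemma pairing_coord u w : pairing f u w
  = \sum_j w j 0 * pairing f u (cplx_mx (basis_vec R j)).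
Proof. exact: rcons_coord. Qed.

Lemma pairing_coordl u w : pairing f u w
  = \sum_i u i 0 * pairing f (cplx_mx (basis_vec R i)) w.
Proof.
rewrite pairing_swap pairing_coord -sumrN; apply: eq_bigr => i _.
by rewrite -mulrN -pairing_swap.
Qed.

Lemma Re_sum (I : finType) (F : I -> R[i]) :
  complex.Re (\sum_i F i) = \sum_i complex.Re (F i).
Proof. by apply: (big_morph (@complex.Re R)) => // -[a b] [a' b']. Qed.

Lemma Re_scale (c : R) (z : R[i]) : complex.Re (c%:C%C * z) = c * complex.Re z.
Proof. by case: z => a b /=; rewrite mul0r subr0. Qed.

Lemma Re_pairing (a b : 'cV[R]_d) :
  complex.Re (pairing f (cplx_mx a) (cplx_mx b)) = bilf (re_form_mx f) a b.
Proof.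
rewrite pairing_coordl Re_sum bilfE; apply: eq_bigr => i _.
rewrite mxE Re_scale pairing_coord Re_sum mulr_sumr; apply: eq_bigr => j _.
by rewrite mxE Re_scale !mxE; ring.
Qed.

Lemma Im_pairing (a b : 'cV[R]_d) :
  complex.Im (pairing f (cplx_mx a) (cplx_mx b)) = - bilf (re_form_mx f) a (J *m b).
Proof.
rewrite -Re_pairing cplx_mxM pairing_J; case: (pairing _ _ _) => x y /=.
by rewrite mul0r mul1r sub0r opprK.
Qed.

Lemma Phi_anti : (re_form_mx f)^T = - re_form_mx f.
Proof. by apply/matrixP => i j; rewrite !mxE pairing_swap; case: (pairing _ _ _). Qed.

Lemma Phi_J : J^T *m re_form_mx f = re_form_mx f *m J.
Proof.
apply: bilf_ext => u v; rewrite -bilfMl -bilfMr -!Re_pairing !cplx_mxM.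
by rewrite pairing_J pairing_Jl.
Qed.

Variable G : 'M[R]_d.
Hypothesis symG : G^T = G.
Hypothesis posG : forall v : 'cV[R]_d, v != 0 -> 0 < bilf G v v.
Hypothesis hermG : J^T *m G *m J = G.
Hypothesis cross : forall e : 'I_1 -> VC, orthonormal G e ->
  conorm G (fun k => f (rcons_vec e (cplx_mx (basis_vec R k)))) = 2.

(** A unit real vector [a] gives the unit vector (a - i J a)/sqrt 2 of type (1,0),
    where the form takes sqrt 2 times its value on [a]; the real and imaginary
    parts of the latter covector have equal norms because they differ by [J]. *)
Lemma Phi_iso a : bilf G a a = 1 ->
  bilf (re_form_mx f *m invmx G *m (re_form_mx f)^T) a a = 1.
Proof.
move=> aa; pose Phi := re_form_mx f.
pose e : VC := isqrt2 R *: (cplx_mx a - 'i%C *: cplx_mx (J *m a)).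
have GJ (u v : 'cV[R]_d) : bilf G (J *m u) (J *m v) = bilf G u v.
  by rewrite bilfMl bilfMr hermG.
have Te : T10 e by apply: T10Z; exact: T10_real.
have ee : herm G e e = 1.
  have -> : e = isqrt2 R *: (cplx_mx a + 'i%C *: cplx_mx (- (J *m a))).
    by rewrite /e cplx_mxN scalerN.
  rewrite hermZl (hermZr symG) isqrt2_conj mulrA (herm_ReIm symG).
  rewrite bilfNl bilfNr opprK GJ aa -[1 + 1]/(2%:R) rmorph_nat mulrC.
  exact: isqrt2_sqr.
have fe w : pairing f e w = 2 * isqrt2 R * pairing f (cplx_mx a) w.
  rewrite /e pairingZl pairingBl cplx_mxM pairing_Jl mulrA mulii mulN1r opprK.
  by ring.
have eo : orthonormal G (fun _ : 'I_1 => e).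
  by split=> // i j; rewrite ee (ord1 i) (ord1 j) eqxx.
have := cross eo; rewrite /conorm; set S := \sum_i _ => S2.
have {S2}S4 : complex.Re S = 4.
  have [S0|S0] := lerP 0 (complex.Re S); last first.
    move: S2; rewrite ltr0_sqrtr// => /esym/eqP.
    by rewrite pnatr_eq0.
  by rewrite -[LHS]sqr_sqrtr// S2; ring.
pose p : 'cV[R]_d := Phi^T *m a; pose q : 'cV[R]_d := - (Phi^T *m (J *m a)).
have fa k : pairing f (cplx_mx a) (cplx_mx (basis_vec R k)) = (p k 0 +i* q k 0)%C.
  apply/eqP; rewrite eq_complex/= Re_pairing Im_pairing; apply/andP; split; apply/eqP.
    by rewrite -bilf_tr /bilf trmx_delta -mulmxA -rowE mxE.
  rewrite bilfMr -Phi_J -bilfMl -bilf_tr /bilf trmx_delta -mulmxA -rowE.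
  by rewrite [RHS]mxE; congr (- _); rewrite mxE.
have SE : complex.Re S = 2 * (bilf (invmx G) p p + bilf (invmx G) q q).
  rewrite Re_sum !bilfE -big_split mulr_sumr; apply: eq_bigr => i _ /=.
  rewrite Re_sum -big_split mulr_sumr; apply: eq_bigr => j _ /=.
  rewrite -/(pairing f e _) -/(pairing f e (cplx_mx (basis_vec R j))) !fe !fa.
  rewrite !conjcM isqrt2_conj conjc_nat mxE.
  transitivity (complex.Re ((2 * (2 * (isqrt2 R * isqrt2 R)))
    * ((invmx G i j)%:C%C * ((p i 0 +i* q i 0)%C * ((p j 0 +i* q j 0)%C)^*%C)))).
    by congr complex.Re; ring.
  rewrite isqrt2_sqr mulr1 -(rmorph_nat (real_complex R)) !Re_scale /=.
  ring.
have Jp : bilf (invmx G) q q = bilf (invmx G) p p.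
  have PtJ : Phi^T *m J = J^T *m Phi^T.
    by rewrite Phi_anti mulNmx mulmxN Phi_J.
  rewrite /q bilfNl bilfNr opprK mulmxA PtJ -mulmxA -/p bilfMl bilfMr trmxK.
  congr bilf; rewrite -mulmxA (invG_J posG hermG) mulmxA mulmxN stdJ_sqr opprK.
  by rewrite mul1mx.
have : bilf (invmx G) p p = 1 by move: SE; rewrite S4 Jp => H; lra.
by rewrite /p bilfMl bilfMr trmxK.
Qed.

End TwoForm.

(** * Holomorphic forms in a Kähler chart *)

Section CauchyRiemann.
Variables (R : realType) (n : nat).
Local Notation V := 'cV[R]_(n + n).
Local Notation J := (@stdJ R n).

(** The antiholomorphic derivative is taken along u + i J u. *)
Lemma cauchy_riemann (h : V -> R[i]) (y u : V) :
  (forall w, T01 w -> derive_CC h y w = 0) ->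
  'D_(J *m u) (fun z => complex.Re (h z)) y = - 'D_u (fun z => complex.Im (h z)) y
  /\ 'D_(J *m u) (fun z => complex.Im (h z)) y = 'D_u (fun z => complex.Re (h z)) y.
Proof.
move=> /(_ _ (T01_real u)); rewrite /derive_CC /derive_C.
have -> : map_mx (@complex.Re R) (cplx_mx u + 'i%C *: cplx_mx (J *m u)) = u.
  by apply/matrixP => i j; rewrite !mxE /= !(mul0r, mul1r, mulr0) subr0 addr0.
have -> : map_mx (@complex.Im R) (cplx_mx u + 'i%C *: cplx_mx (J *m u)) = J *m u.
  by apply/matrixP => i j; rewrite 4!mxE /= [cplx_mx _ _ _]mxE /= !(mul0r, mul1r, mulr0) !add0r.
move=> /eqP; rewrite eq_complex /= => /andP[/eqP E1 /eqP E2].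
split; lra.
Qed.

End CauchyRiemann.

(** For a parallel endomorphism the derivatives in the Nijenhuis tensor are
    commutators with the connection, and these cancel by torsion-freeness. *)
Lemma parallel_integrable (R : realType) (n : nat)
    (Gam I : 'cV[R]_(n + n) -> 'M[R]_(n + n)) (y : 'cV[R]_(n + n)) :
  (forall u v, Gam u *m v = Gam v *m u) ->
  (forall w, 'D_w I y + Gam w *m I y - I y *m Gam w = 0) ->
  I y *m I y = - 1%:M ->
  forall u v, nijenhuis I y u v = 0.
Proof.
move=> symG par II u v; rewrite /nijenhuis.
have DI w : 'D_w I y = I y *m Gam w - Gam w *m I y.
  by apply/eqP; rewrite -subr_eq0 opprB addrA; apply/eqP; exact: par.
rewrite !DI; move: (I y) II => X XX.
have XK (x : 'cV[R]_(n + n)) : X *m (X *m x) = - x by rewrite mulmxA XX mulNmx mul1mx.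
rewrite !mulmxBl !mulmxBr -!mulmxA !XK.
rewrite (symG (X *m u) v) (symG (X *m u) (X *m v)) (symG (X *m v) u) (symG v u).
move: (X *m (Gam v *m _)) (Gam (X *m v) *m _) (X *m (Gam u *m _)) (Gam u *m v).
by move=> a b c e; apply/colP => i; rewrite !mxE; ring.
Qed.

Section HolomorphicTwoForm.
Variables (R : realType) (n : nat).
Local Notation V := 'cV[R]_(n + n).
Local Notation VC := 'cV[R[i]]_(n + n).
Variables (D : set V) (G : V -> 'M[R]_(n + n)).
Local Notation J := (@stdJ R n).
Hypotheses (oD : open D) (sG : smooth_on D G).
Hypothesis symG : forall y, D y -> (G y)^T = G y.
Hypothesis posG : forall y, D y -> forall v : V, v != 0 -> 0 < bilf (G y) v v.
Hypothesis hermG : forall y, D y -> J^T *m G y *m J = G y.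
Hypothesis closedG : forall y, D y -> forall u v w : V,
    'D_u (fun z => ((J *m v)^T *m G z *m w) 0 0) y
    + 'D_v (fun z => ((J *m w)^T *m G z *m u) 0 0) y
    + 'D_w (fun z => ((J *m u)^T *m G z *m v) 0 0) y = 0.
Variable phi : V -> ('I_2 -> VC) -> R[i].
Hypothesis formP : forall y, D y -> form_at (phi y).
Hypothesis sphi : forall v,
  smooth_on D (fun y => complex.Re (phi y v) : R^o) /\
  smooth_on D (fun y => complex.Im (phi y v) : R^o).
Hypothesis holphi : forall y, D y -> forall v w, T01 w ->
  derive_CC (fun z => phi z v) y w = 0.
Hypothesis cross : forall y, D y -> forall e : 'I_1 -> VC, orthonormal (G y) e ->
  conorm (G y) (fun k => phi y (rcons_vec e (cplx_mx (basis_vec R k)))) = 2.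

Let Phi z := re_form_mx (phi z).

Definition sharp_field (z : V) : 'M[R]_(n + n) := sharp_mx (G z) (Phi z).

Let unitG z : D z -> G z \in unitmx.
Proof. by move=> Dz; apply: posdef_unitmx; exact: posG. Qed.

Lemma Phi_smooth : smooth_on D Phi.
Proof.
apply: smooth_mx => // i j; rewrite /Phi /re_form_mx.
under eq_fun do rewrite mxE; exact: (sphi _).1.
Qed.

Lemma sharp_field_smooth : smooth_on D sharp_field.
Proof.
have -> : sharp_field = fun z => (- 1%:M) *m (invmx (G z) *m Phi z).
  by apply/funext => z; rewrite mulNmx mul1mx.
apply: smooth_mulmx => //; first exact: smooth_cst.
by apply: smooth_mulmx => //; [exact: smooth_invmx | exact: Phi_smooth].
Qed.

Let iso z (Dz : D z) := Phi_iso (formP Dz) (symG Dz) (posG Dz) (hermG Dz) (cross Dz).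

Lemma sharp_field_sqr z : D z -> sharp_field z *m sharp_field z = - 1%:M.
Proof.
move=> Dz; apply: sharp_sqr; [exact: symG|exact: posG|exact: (Phi_anti (formP Dz))|exact: iso].
Qed.

Lemma sharp_field_J z : D z -> sharp_field z *m J = - (J *m sharp_field z).
Proof.
move=> Dz; apply: sharp_J; [exact: posG|exact: hermG|exact: (Phi_J (formP Dz))].
Qed.

Lemma sharp_field_herm z : D z -> (sharp_field z)^T *m G z *m sharp_field z = G z.
Proof.
move=> Dz; apply: sharp_herm; [exact: symG|exact: posG|exact: (Phi_anti (formP Dz))|exact: iso].
Qed.

Lemma sharp_field_even z : D z -> ~~ odd n.
Proof.
move=> Dz; apply: (quaternionic_even (symG Dz) (posG Dz) (Phi_anti (formP Dz)) (Phi_J (formP Dz))).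
exact: iso.
Qed.

Variables (y : V) (Dy : D y).
Local Notation Gam := (conn G y).

Let dPhi : differentiable Phi y. Proof. exact: (Phi_smooth [::]). Qed.
Let dX : differentiable sharp_field y. Proof. exact: (sharp_field_smooth [::]). Qed.
Let dG : differentiable G y. Proof. exact: (sG [::]). Qed.

(** The imaginary part of the form is minus its real part with [J] applied to the
    second argument, so the Cauchy-Riemann equations close up on the real part. *)
Lemma dPhi_J u : 'D_(J *m u) Phi y = 'D_u Phi y *m J.
Proof.
rewrite -derive_mxconst//; apply/matrixP => i j.
have dPJ : differentiable (fun z => Phi z *m J) y.
  by apply: differentiable_mulmx => //; exact: differentiable_cst.
have L := derive_entry (J *m u) i j dPhi.
have Rr := derive_entry u i j dPJ.
rewrite L Rr.
pose h z := pairing (phi z) (cplx_mx (basis_vec R i)) (cplx_mx (basis_vec R j)).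
have [CR _] : 'D_(J *m u) (fun z => complex.Re (h z)) y
    = - 'D_u (fun z => complex.Im (h z)) y /\ _ :=
  cauchy_riemann u (holphi Dy _).
have -> : (fun z => Phi z i j) = fun z => complex.Re (h z).
  by apply/funext => z; rewrite mxE.
rewrite CR -mulN1r -derive_scalar; last exact: ((sphi _).2 [::]).
apply: (derive_eq_on _ oD _ Dy) => z Dz.
by rewrite mulN1r (Im_pairing (formP Dz)) opprK bilfMr bilf_delta.
Qed.

(** Differentiating [G *m X = - Phi] and replacing the derivative of [G] by the
    connection. *)
Lemma mul_nabla_sharp w :
  G y *m ('D_w sharp_field y + Gam w *m sharp_field y - sharp_field y *m Gam w)
  = - 'D_w Phi y + (Gam w)^T *m Phi y + Phi y *m Gam w.
Proof.
have GXz z : D z -> G z *m sharp_field z = - 1%:M *m Phi z.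
  by move=> Dz; rewrite mulNmx mul1mx /sharp_field mul_sharp//; exact: posG.
have E : 'D_w (fun z => G z *m sharp_field z) y = 'D_w (fun z => - 1%:M *m Phi z) y.
  exact: (derive_eq_on _ oD GXz Dy).
have GXy : G y *m sharp_field y = - Phi y by rewrite GXz// mulNmx mul1mx.
move: E; rewrite derive_mulmx// derive_constmx// mulNmx mul1mx.
rewrite (conn_metric oD sG symG posG Dy) mulmxDl -mulmxA GXy mulmxN.
rewrite mulmxBr mulmxDr !mulmxA GXy mulNmx opprK.
move: (G y *m 'D_w sharp_field y) ((Gam w)^T *m Phi y) (G y *m Gam w *m sharp_field y) => A B C E.
apply/matrixP => i j; move/matrixP: E => /(_ i j); rewrite !mxE => E; lra.
Qed.

(** By holomorphy the covariant derivatives along [w] and [J w] differ by the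
    factor [J], and X squared is constant; the rest is algebra. *)
Lemma sharp_field_parallel w :
  'D_w sharp_field y + Gam w *m sharp_field y - sharp_field y *m Gam w = 0.
Proof.
pose N u := 'D_u sharp_field y + Gam u *m sharp_field y - sharp_field y *m Gam u.
have GJ u : Gam u *m J = J *m Gam u by exact: (conn_J oD sG symG posG hermG closedG Dy).
have NX u : N u *m sharp_field y + sharp_field y *m N u = 0.
  have E : 'D_u (fun z => sharp_field z *m sharp_field z) y = 'D_u (fun=> - 1%:M : 'M[R]_(n + n)) y.
    exact: (derive_eq_on _ oD sharp_field_sqr Dy).
  move: E; rewrite derive_cst derive_mulmx// /N => E.
  have GXX : Gam u *m sharp_field y *m sharp_field y = - Gam u.
    by rewrite -mulmxA sharp_field_sqr// mulmxN mulmx1.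
  have XXG : sharp_field y *m sharp_field y *m Gam u = - Gam u.
    by rewrite sharp_field_sqr// mulNmx mul1mx.
  rewrite !mulmxBl !mulmxBr !mulmxDl !mulmxDr !mulmxA GXX XXG.
  move: E; move: (sharp_field y *m Gam u *m sharp_field y) => C.
  move: ('D_u sharp_field y *m sharp_field y) (sharp_field y *m 'D_u sharp_field y) => A B E.
  apply/matrixP => i j; move/matrixP: E => /(_ i j); rewrite !mxE; lra.
apply: (@parallel_of_quaternionic _ _ (sharp_field y) (N w) (N (J *m w))).
- exact: sharp_field_sqr.
- exact: sharp_field_J.
- exact: NX.
- exact: NX.
have E : G y *m N (J *m w) = G y *m (N w *m J).
  rewrite [RHS]mulmxA !mul_nabla_sharp dPhi_J.
  rewrite (conn_Jdir oD sG symG posG hermG closedG Dy) trmx_mul !mulmxDl !mulNmx.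
  have PJ := Phi_J (formP Dy); rewrite -!mulmxA PJ; congr (_ + _).
  by rewrite GJ.
by rewrite -[LHS](mulKmx (unitG Dy)) E mulKmx// unitG.
Qed.

End HolomorphicTwoForm.

(** * The case of top-degree forms: volume forms of constant length *)

Section TopForm.
Variables (R : realType) (n : nat).
Local Notation d := (n + n)%N.
Local Notation C := R[i].
Local Notation VC := 'cV[C]_d.
Local Notation J := (@stdJ R n).
Local Notation JC := (cplx_mx J).
Local Notation TT := (@T10mx R n).

(** The differentials dz^1, ..., dz^n applied to a complexified vector. *)
Definition dz : 'M[C]_(n, d) := row_mx 1%:M ('i%C)%:M.

Lemma T10mx_dz : TT *m dz = 1%:M - 'i%C *: JC.
Proof.
have -> : JC = block_mx 0 (- 1%:M) 1%:M 0.
  by rewrite /cplx_mx map_block_mx !map_mx0 map_mxN map_mx1.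
rewrite /dz /T10mx mul_col_row !mul1mx !mulmx1.
rewrite scalar_mx_block scale_block_mx opp_block_mx add_block_mx !scaler0 !oppr0 !addr0.
rewrite !add0r -scalar_mxM mulNr mulii opprK scalerN opprK.
by rewrite scale_scalar_mx mulr1 (raddfN (@scalar_mx C n)).
Qed.

Lemma dz_T10mx : dz *m TT = 2%:M.
Proof.
rewrite /dz /T10mx mul_row_col mul1mx -scalar_mxM mulrN mulii opprK -raddfD.
by congr (_%:M); rewrite -[1 + 1]/(2%:R).
Qed.

(** The coordinate vectors d/dz^1, ..., d/dz^n, dual to [dz]. *)
Definition std_frame (k : 'I_n) : VC := 2^-1 *: col k TT.

Definition coords (v : 'I_n -> VC) : 'M[C]_n := \matrix_(i, j) (dz *m v j) i 0.

(** [T10mx *m dz] is twice the projection to the vectors of type (1,0). *)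
Lemma T01_split (v : VC) : T01 (v - \sum_i (dz *m v) i 0 *: std_frame i).
Proof.
have -> : \sum_i (dz *m v) i 0 *: std_frame i = 2^-1 *: (TT *m (dz *m v)).
  apply/colP => a; rewrite summxE [RHS]mxE [X in _ = _ * X]mxE mulr_sumr.
  by apply: eq_bigr => i _; rewrite !mxE; ring.
rewrite mulmxA T10mx_dz mulmxBl mul1mx -scalemxAl.
have -> : v - 2^-1 *: (v - 'i%C *: (JC *m v)) = 2^-1 *: (v + 'i%C *: (JC *m v)).
  by apply/colP => a; rewrite !mxE; field.
rewrite /T01 -!scalemxAr scalerA mulrC -scalerA; congr (_ *: _).
rewrite mulmxDr -scalemxAr JCK scalerDr scalerA mulNr mulii opprK scale1r.
by rewrite scaleNr scalerN addrC.
Qed.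

Lemma dz_T01 (v : VC) : T01 v -> dz *m v = 0.
Proof.
move=> Tv; have E : TT *m (dz *m v) = 0.
  by rewrite mulmxA T10mx_dz mulmxBl mul1mx -scalemxAl Tv scalerA mulrN mulii opprK
    scale1r subrr.
have : dz *m TT *m (dz *m v) = 0 by rewrite -mulmxA E mulmx0.
by rewrite dz_T10mx mul_scalar_mx => /eqP; rewrite scaler_eq0 pnatr_eq0 => /eqP.
Qed.

Lemma coords_dfwith v i u : coords (dfwith v i u)
  = \matrix_(a, j) if j == i then (dz *m u) a 0 else coords v a j.
Proof.
apply/matrixP => a j; rewrite [LHS]mxE [RHS]mxE; have [->|ji] := eqVneq j i.
  by rewrite dfwithin.
by rewrite dfwithout 1?eq_sym// [RHS]mxE.
Qed.

Lemma coords_det_form : form_at (fun v : 'I_n -> VC => \det (coords v)).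
Proof.
split=> [v i c u w|v i j ij vij|v i Tv].
- have dt (N : 'M[C]_n) : \det N = \det N^T by rewrite det_tr.
  rewrite (dt (coords (dfwith v i (c *: u + w)))) (dt (coords (dfwith v i u))).
  rewrite (dt (coords (dfwith v i w))) -[\det (coords (dfwith v i w))^T]mul1r.
  apply: (@determinant_multilinear _ _ _ _ _ i c 1).
  + apply/rowP => a; rewrite !coords_dfwith scale1r !mxE eqxx mulr_sumr -big_split.
    apply: eq_bigr => b _ /=; rewrite !mxE; ring.
  + apply/matrixP => a b; rewrite !coords_dfwith !mxE.
    by rewrite eq_sym (negPf (neq_lift _ _)).
  + apply/matrixP => a b; rewrite !coords_dfwith !mxE.
    by rewrite eq_sym (negPf (neq_lift _ _)).
- rewrite -det_tr; apply: (determinant_alternate ij) => a.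
  by rewrite !mxE vij.
- rewrite (expand_det_col _ i) big1// => a _.
  by rewrite mxE dz_T01// mxE mul0r.
Qed.

Section Vanish.
Variables (f : ('I_n -> VC) -> C) (fP : form_at f).

Lemma form_tperm v i j : i != j -> f (v \o tperm i j) = - f v.
Proof.
move=> ij.
have -> : v \o tperm i j = dfwith (dfwith v i (v j)) j (v i).
  apply/funext => k /=; case: tpermP => [->|->|/eqP ki /eqP kj].
  - by rewrite dfwithout 1?eq_sym// dfwithin.
  - by rewrite dfwithin.
  - by rewrite !dfwithout 1?eq_sym.
rewrite (kform_swap fP)//; congr (- f _).
by rewrite dfwith_id dfwith_id.
Qed.

Lemma form_perm0 (s : 'S_n) v : f v = 0 -> f (v \o s) = 0.
Proof.
case: (prod_tpermP s) => ts -> dts; elim: ts dts v => [|t ts IH] /= dts v fv.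
  by rewrite big_nil; have -> : v \o (1%g : 'S_n) = v
    by apply/funext => k /=; rewrite perm1.
move/andP: dts => [dt dts]; rewrite big_cons.
have -> : v \o (tperm t.1 t.2 * \prod_(t0 <- ts) tperm t0.1 t0.2)%g
    = (v \o (\prod_(t0 <- ts) tperm t0.1 t0.2)%g) \o tperm t.1 t.2.
  by apply/funext => k /=; rewrite permM.
by rewrite form_tperm// IH// oppr0.
Qed.

(** An alternating form killed by the frame is killed by all rearrangements of it,
    and then, expanding one argument at a time, everywhere. *)
Lemma form_vanish : f std_frame = 0 -> forall v, f v = 0.
Proof.
move=> ft.
have fh (h : 'I_n -> 'I_n) : f (std_frame \o h) = 0.
  have [hi|/injectivePn[i [j ij hij]]] := boolP (injectiveb h); last first.
    by have [_ alt _] := fP; apply: (alt _ i j ij); rewrite /= hij.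
  have -> : std_frame \o h = std_frame \o perm (injectiveP _ hi).
    by apply/funext => k /=; rewrite permE.
  exact: form_perm0.
suff H (m : nat) v : (forall i : 'I_n, (m <= i)%N -> exists j, v i = std_frame j) -> f v = 0.
  by move=> v; apply: (H n) => i; rewrite leqNgt ltn_ord.
elim: m v => [|m IH] v vt.
  have [h hP] : exists h : 'I_n -> 'I_n, forall i, v i = std_frame (h i).
    exact: (@fin_all_exists _ (fun=> 'I_n) (fun i j => v i = std_frame j)
      (fun i => vt i (leq0n i))).
  by have -> : v = std_frame \o h by apply/funext.
have [mn|nm] := ltnP m n; last first.
  by apply: IH => i mi; have := leq_trans nm mi; rewrite leqNgt ltn_ord.
pose i0 := Ordinal mn.
rewrite -(dfwith_id v i0) -[v i0](subrK (\sum_i (dz *m v i0) i 0 *: std_frame i)).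
rewrite (kformD fP) (kform_sum fP) [X in _ + X]big1 ?addr0 => [|j _].
  have [_ _ T] := fP; apply: (T _ i0); rewrite dfwithin; exact: T01_split.
rewrite IH ?mulr0// => i mi; have [<-|ii0] := eqVneq i0 i.
  by exists j; rewrite dfwithin.
rewrite dfwithout//; apply: vt; rewrite ltn_neqAle mi andbT.
by apply: contraNneq ii0 => E; apply/eqP/val_inj.
Qed.

End Vanish.

(** The difference of the two sides is again a form of type (n,0), and it vanishes
    on the coordinate frame. *)
Lemma form_top (f : ('I_n -> VC) -> C) v : form_at f ->
  f v = f std_frame * \det (coords v).
Proof.
move=> fP; have DP := coords_det_form.
pose f' v := f v - f std_frame * \det (coords v).
suff f'P : form_at f'.
  have f't : f' std_frame = 0.
    rewrite /f' (_ : coords std_frame = 1%:M) ?det1 ?mulr1 ?subrr//.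
    apply/matrixP => i j; rewrite mxE /std_frame -scalemxAr colE mulmxA dz_T10mx -colE.
    rewrite !mxE; case: eqP => _; last by rewrite mulr0n mulr0.
    by rewrite mulr1n mulVf// pnatr_eq0.
  by apply/eqP; rewrite -subr_eq0; apply/eqP; exact: (form_vanish f'P).
have [L A T] := fP; have [L' A' T'] := DP.
split=> [w i c u x|w i j ij wij|w i Tw]; rewrite /f'.
- by rewrite L L'; ring.
- by rewrite (A _ i j)// (A' _ i j)// mulr0 subrr.
- by rewrite (T _ i)// (T' _ i)// mulr0 subrr.
Qed.

(** Expanding each determinant along its replaced column pairs the entries of
    [B *m Z] with the adjugate of [Z]. *)
Lemma sum_det_trace (Z B : 'M[C]_n) :
  \sum_i \det (\matrix_(a, j) if j == i then (B *m Z) a i else Z a j)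
  = \tr B * \det Z.
Proof.
have -> : \tr B * \det Z = \tr (B *m Z *m \adj Z).
  by rewrite -mulmxA mul_mx_adj mul_mx_scalar mxtraceZ mulrC.
rewrite mxtrace_mulC /mxtrace; apply: eq_bigr => i _.
rewrite (expand_det_col _ i) mxE; apply: eq_bigr => a _.
rewrite !mxE eqxx [LHS]mulrC; congr (_ * _).
rewrite /cofactor; congr (_ * \det _); apply/matrixP => p q.
by rewrite !mxE eq_sym (negPf (neq_lift _ _)).
Qed.

(** [Gam] commutes with [J], hence acts on dz^1, ..., dz^n by a complex matrix; its
    trace is expressed by the real traces of [Gam] and [J *m Gam]. *)
Lemma form_top_trace (f : ('I_n -> VC) -> C) (Gam : 'M[R]_d) v : form_at f ->
  Gam *m J = J *m Gam ->
  \sum_i f (dfwith v i (cplx_mx Gam *m v i))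
  = (2^-1 * ((\tr Gam)%:C%C - 'i%C * (\tr (J *m Gam))%:C%C)) * f v.
Proof.
move=> fP GJ; pose B := 2^-1 *: (dz *m cplx_mx Gam *m TT).
have Bdz : B *m dz = dz *m cplx_mx Gam.
  rewrite /B -scalemxAl -!mulmxA T10mx_dz mulmxBr mulmx1 -scalemxAr -cplx_mxM GJ cplx_mxM.
  have -> : cplx_mx Gam - 'i%C *: (JC *m cplx_mx Gam) = (1%:M - 'i%C *: JC) *m cplx_mx Gam.
    by rewrite mulmxBl mul1mx -scalemxAl.
  by rewrite -T10mx_dz !mulmxA dz_T10mx mul_scalar_mx -!scalemxAl scalerA mulVf ?scale1r.
have trB : \tr B = 2^-1 * ((\tr Gam)%:C%C - 'i%C * (\tr (J *m Gam))%:C%C).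
  have trC (X : 'M[R]_d) : \tr (cplx_mx X) = (\tr X)%:C%C by rewrite /cplx_mx trace_map_mx.
  rewrite /B mxtraceZ mxtrace_mulC mulmxA T10mx_dz mulmxBl mul1mx -scalemxAl.
  by rewrite raddfB/= mxtraceZ -cplx_mxM !trC.
rewrite -trB; under eq_bigr do rewrite (form_top _ fP).
rewrite -mulr_sumr (form_top v fP) mulrCA; congr (_ * _).
rewrite -sum_det_trace; apply: eq_bigr => i _; congr (\det _).
rewrite coords_dfwith; apply/matrixP => a j; rewrite [LHS]mxE [RHS]mxE; case: eqP => // _.
rewrite mulmxA -Bdz -mulmxA [LHS]mxE [RHS]mxE; apply: eq_bigr => b _.
by rewrite [coords _ _ _]mxE.
Qed.

End TopForm.

Section ConstantLength.
Variables (R : realType) (r : nat).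
Local Notation n := r.+1.
Local Notation d := (n + n)%N.
Local Notation C := R[i].
Local Notation VC := 'cV[C]_d.
Local Notation J := (@stdJ R n).
Local Notation TT := (@T10mx R n).

Definition sq_norm (z : C) : R := complex.Re z ^+ 2 + complex.Im z ^+ 2.

Lemma sq_normE z : (sq_norm z)%:C%C = z * z^*%C.
Proof.
by apply/eqP; rewrite eq_complex /sq_norm; case: z => a b /=; apply/andP; split;
  apply/eqP; ring.
Qed.

Lemma real_complexM (a b : R) : (a * b)%:C%C = a%:C%C * b%:C%C :> C.
Proof. exact: rmorphM. Qed.

(** The frame d/dz, d/dzbar in terms of d/dx, d/dy. *)
Definition fullT : 'M[C]_d := 2^-1 *: row_mx TT (map_mx conjc TT).

(** On a unitary frame [E] the form has squared modulus [c], because the slice by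
    all members but the last has a single nonzero entry, its value on [E]; so the
    squared modulus on the coordinate frame is [c] divided by that of
    [z = \det (coords E)].  The fourth
    power of the modulus of [z] is the inverse of the real determinant of the
    metric, up to the constant that compares the frames d/dz, d/dzbar and
    d/dx, d/dy. *)
Lemma top_norm (G : 'M[R]_d) (f : ('I_n -> VC) -> C) (c : R) :
  G^T = G -> (forall v : 'cV[R]_d, v != 0 -> 0 < bilf G v v) ->
  J^T *m G *m J = G -> form_at f -> 0 < c ->
  (forall e : 'I_r -> VC, orthonormal G e ->
    conorm G (fun k => f (rcons_vec e (cplx_mx (basis_vec R k)))) ^+ 2 = c) ->
  0 < sq_norm (f (@std_frame R n)) /\
  sq_norm (f (@std_frame R n)) ^+ 2 = c ^+ 2 * sq_norm (\det fullT) * \det G.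
Proof.
move=> symG posG hermG fP c0 cross.
have [e0 [Te He]] := unitary_frame symG posG (leqnn n).
pose E (i : 'I_n) := e0 i.
have Eo : orthonormal G E by split=> [i|i j]; [exact: Te | rewrite He].
have fE : f E * (f E)^*%C = c%:C%C.
  have eo : orthonormal G (fun i : 'I_r => E (lift ord_max i)).
    by split=> [i|i j]; [exact: Eo.1 | rewrite Eo.2 (inj_eq lift_inj)].
  have rE k : rcons_vec (fun i : 'I_r => E (lift ord_max i)) (E k)
      = dfwith E ord_max (E k).
    apply/funext => l; case: (unliftP ord_max l) => [i ->|->].
      by rewrite rcons_vec_lift dfwithout ?neq_lift.
    by rewrite rcons_vec_max dfwithin.
  rewrite -(slice_norm posG hermG fP cross Eo eo) /inner (bigD1 ord_max)//= big1 ?addr0.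
    by rewrite /slice rE dfwith_id.
  move=> k kmax; have [_ alt _] := fP.
  rewrite /slice rE (alt _ k ord_max)// ?mul0r//.
  by rewrite dfwithin dfwithout// eq_sym.
pose z := \det (coords E).
have UU := frame_full hermG Eo.1 Eo.2.
set F : 'M[C]_(d, n) := \matrix_(a, k) _ in UU; set U := row_mx _ _ in UU.
have Fcol k : col k F = E k by apply/colP => a; rewrite !mxE.
have FE : F = (2^-1 *: TT) *m coords E.
  apply/matrixP => a k; have Tk : cplx_mx J *m E k = 'i%C *: E k := Eo.1 k.
  have /(congr1 (fun v : VC => v a 0)) : TT *m (dz R n *m E k) = 2 *: E k.
    rewrite mulmxA T10mx_dz mulmxBl mul1mx -scalemxAl Tk scalerA mulii scaleN1r opprK.
    by rewrite -mulr2n scaler_nat.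
  rewrite mxE [X in _ = X -> _]mxE => E2; rewrite [LHS]mxE [RHS]mxE -[LHS](@mulKf _ 2) ?pnatr_eq0//.
  rewrite -E2 mulr_sumr; apply: eq_bigr => b _.
  by rewrite mulrA; congr (_ * _); rewrite [RHS]mxE.
have conj_half m k (X : 'M[C]_(m, k)) :
    map_mx conjc (2^-1 *: X) = 2^-1 *: map_mx conjc X.
  by apply/matrixP => i j; rewrite !mxE conjcM conjc_inv conjc_nat.
have UE : U = fullT *m block_mx (coords E) 0 0 (map_mx conjc (coords E)).
  rewrite /U FE conj_mxM conj_half /fullT scale_row_mx mul_row_block.
  by rewrite !mulmx0 addr0 add0r.
have detU : \det U = \det fullT * (z * z^*%C).
  by rewrite UE det_mulmx det_lblock det_map_mx.
have D1 : (sq_norm (\det U) * \det G)%:C%C = 1.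
  have := congr1 (fun N => \det N) UU; rewrite !det_mulmx det_tr det1 !det_map_mx.
  by rewrite real_complexM sq_normE => <-; ring.
have q2 : sq_norm (f (@std_frame R n)) * sq_norm z = c.
  apply: complexI; rewrite -fE (form_top E fP) real_complexM !sq_normE conjcM -/z; ring.
have {}D1 : sq_norm (\det fullT) * sq_norm z ^+ 2 * \det G = 1.
  apply: complexI; transitivity (1 : C); last by [].
  rewrite -D1 detU !real_complexM !sq_normE !conjcM conjcK; ring.
split.
  rewrite lt_neqAle addr_ge0 ?sqr_ge0// andbT eq_sym.
  by apply: contraTneq c0 => q0; rewrite -q2 q0 mul0r ltxx.
rewrite -[LHS]mulr1 -D1 -q2; ring.
Qed.

End ConstantLength.

Section HolomorphicTopForm.
Variables (R : realType) (r : nat).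
Local Notation n := r.+1.
Local Notation C := R[i].
Local Notation V := 'cV[R]_(n + n).
Local Notation VC := 'cV[R[i]]_(n + n).
Variables (D : set V) (G : V -> 'M[R]_(n + n)).
Local Notation J := (@stdJ R n).
Hypotheses (oD : open D) (sG : smooth_on D G).
Hypothesis symG : forall y, D y -> (G y)^T = G y.
Hypothesis posG : forall y, D y -> forall v : V, v != 0 -> 0 < bilf (G y) v v.
Hypothesis hermG : forall y, D y -> J^T *m G y *m J = G y.
Hypothesis closedG : forall y, D y -> forall u v w : V,
    'D_u (fun z => ((J *m v)^T *m G z *m w) 0 0) y
    + 'D_v (fun z => ((J *m w)^T *m G z *m u) 0 0) y
    + 'D_w (fun z => ((J *m u)^T *m G z *m v) 0 0) y = 0.
Variable phi : V -> ('I_n -> VC) -> C.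
Hypothesis formP : forall y, D y -> form_at (phi y).
Hypothesis sphi : forall v,
  smooth_on D (fun y => complex.Re (phi y v) : R^o) /\
  smooth_on D (fun y => complex.Im (phi y v) : R^o).
Hypothesis holphi : forall y, D y -> forall v w, T01 w ->
  derive_CC (fun z => phi z v) y w = 0.
Variables (c : R) (c0 : 0 < c).
Hypothesis cross : forall y, D y -> forall e : 'I_r -> VC, orthonormal (G y) e ->
  conorm (G y) (fun k => phi y (rcons_vec e (cplx_mx (basis_vec R k)))) ^+ 2 = c.
Variables (y : V) (Dy : D y).
Local Notation Gam := (conn G y).

Let a z : R := complex.Re (phi z (@std_frame R n)).
Let b z : R := complex.Im (phi z (@std_frame R n)).
Let q z : R := a z * a z + b z * b z.

Let dG : differentiable G y. Proof. exact: (sG [::]). Qed.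
Let da : differentiable a y. Proof. exact: ((sphi _).1 [::]). Qed.
Let db : differentiable b y. Proof. exact: ((sphi _).2 [::]). Qed.

Lemma derive_det_conn w : 'D_w (fun z => \det (G z)) y = 2 * \tr (Gam w) * \det (G y).
Proof.
rewrite derive_det// (conn_metric oD sG symG posG Dy) mulmxDr raddfD/=.
rewrite mxtrace_mulC -mulmxA mul_mx_adj mulmxA mul_adj_mx.
rewrite mul_mx_scalar mul_scalar_mx !mxtraceZ mxtrace_tr; ring.
Qed.

(** The square of [q] is a constant multiple of the determinant of the metric,
    whose logarithmic derivative is twice the trace of the connection. *)
Lemma derive_length w :
  2 * (a y * 'D_w a y + b y * 'D_w b y) = \tr (Gam w) * q y.
Proof.
pose K := c ^+ 2 * sq_norm (\det (@fullT R r)).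
have norm z (Dz : D z) := top_norm (symG Dz) (posG Dz) (hermG Dz) (formP Dz) c0 (cross Dz).
have qE z : q z = sq_norm (phi z (@std_frame R n)) by rewrite /q /sq_norm !expr2.
have qK z : D z -> q z * q z = K * \det (G z).
  by move=> Dz; have [_ <-] := norm z Dz; rewrite qE expr2.
have q0 : 0 < q y by rewrite qE; have [] := norm y Dy.
have daa : differentiable (fun z => a z * a z) y by exact: differentiable_mulr.
have dbb : differentiable (fun z => b z * b z) y by exact: differentiable_mulr.
have dq : differentiable q y by exact: (@differentiableD _ _ _ (fun z => a z * a z)).
have Dq : 'D_w q y = 2 * (a y * 'D_w a y + b y * 'D_w b y).
  rewrite /q (@deriveD _ _ _ (fun z => a z * a z)); try exact: diff_derivable.
  rewrite !derive_mulr//; ring.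
have ddet : differentiable (fun z => \det (G z)) y.
  by have /smooth_onP sGk := sG; apply: (Ck_diff (Ck_det oD (sGk 0)) Dy).
have : 'D_w (fun z => q z * q z) y = 'D_w (fun z => K * \det (G z)) y.
  exact: (derive_eq_on _ oD qK Dy).
rewrite derive_mulr// derive_scalar// derive_det_conn -Dq => E.
apply: (mulfI (lt0r_neq0 q0)); apply: (@mulfI _ 2); first by rewrite pnatr_eq0.
transitivity ('D_w q y * q y + q y * 'D_w q y); first by ring.
rewrite E; transitivity (2 * \tr (Gam w) * (K * \det (G y))); first by ring.
by rewrite -qK//; ring.
Qed.

(** Writing the logarithmic derivative of the length along [w] and along [J w] gives
    two real equations, since the Cauchy-Riemann equations express the derivatives
    of [a] and [b] along [J w] by those along [w]. *)
Lemma derive_coefficient w :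
  2 * 'D_w a y = a y * \tr (Gam w) + b y * \tr (J *m Gam w) /\
  2 * 'D_w b y = b y * \tr (Gam w) - a y * \tr (J *m Gam w).
Proof.
have [CRa CRb] : 'D_(J *m w) a y = - 'D_w b y /\ 'D_(J *m w) b y = 'D_w a y.
  exact: (cauchy_riemann w (holphi Dy _)).
have E1 := derive_length w; have E2 := derive_length (J *m w).
rewrite CRa CRb (conn_Jdir oD sG symG posG hermG closedG Dy) in E2.
have q0 : q y != 0.
  have [] := top_norm (symG Dy) (posG Dy) (hermG Dy) (formP Dy) c0 (cross Dy).
  by rewrite /sq_norm !expr2 -/(q y) => /lt0r_neq0.
split; apply: (mulfI q0).
  transitivity (a y * (2 * (a y * 'D_w a y + b y * 'D_w b y))
      + b y * (2 * (a y * - 'D_w b y + b y * 'D_w a y))); first by rewrite /q; ring.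
  by rewrite E1 E2; ring.
transitivity (b y * (2 * (a y * 'D_w a y + b y * 'D_w b y))
    - a y * (2 * (a y * - 'D_w b y + b y * 'D_w a y))); first by rewrite /q; ring.
by rewrite E1 E2; ring.
Qed.

Lemma top_parallel w v : derive_C (fun z => phi z v) y w
  - \sum_i phi y (dfwith v i (cplx_mx (Gam w) *m v i)) = 0.
Proof.
have GJ : Gam w *m J = J *m Gam w by exact: (conn_J oD sG symG posG hermG closedG Dy).
rewrite (form_top_trace _ (formP Dy) GJ) (form_top v (formP Dy)).
set del := \det (coords v).
have phiE z : D z -> phi z v = (a z +i* b z)%C * del.
  by move=> Dz; rewrite (form_top v (formP Dz)) /a /b; case: (phi z _).
have lin (al be : R) : 'D_w (fun z => al * a z + be * b z) y = al * 'D_w a y + be * 'D_w b y.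
  have dal : differentiable (fun z => al * a z) y by exact: differentiable_mulr.
  have dbe : differentiable (fun z => be * b z) y by exact: differentiable_mulr.
  rewrite (@deriveD _ _ _ (fun z => al * a z)); try exact: diff_derivable.
  by rewrite !derive_scalar.
have DRe : 'D_w (fun z => complex.Re (phi z v)) y
    = complex.Re del * 'D_w a y + - complex.Im del * 'D_w b y.
  rewrite -lin; apply: (derive_eq_on _ oD _ Dy) => z Dz.
  by rewrite phiE//; case: (del) => p s /=; ring.
have DIm : 'D_w (fun z => complex.Im (phi z v)) y
    = complex.Im del * 'D_w a y + complex.Re del * 'D_w b y.
  rewrite -lin; apply: (derive_eq_on _ oD _ Dy) => z Dz.
  by rewrite phiE//; case: (del) => p s /=; ring.
rewrite /derive_C DRe DIm.
have [Ea Eb] := derive_coefficient w.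
have -> : phi y (@std_frame R n) = (a y +i* b y)%C by rewrite /a /b; case: (phi y _).
have -> : 2^-1 = (2^-1)%:C%C :> C by rewrite fmorphV rmorph_nat.
move: Ea Eb; move: ('D_w a y) ('D_w b y) (\tr (Gam w)) (\tr (J *m _)) => a' b' t s Ea Eb.
clear DRe DIm phiE; apply/eqP; case: del => dr di; rewrite eq_complex /=.
have -> : a' = 2^-1 * (a y * t + b y * s) by rewrite -Ea mulrA mulVf ?mul1r// pnatr_eq0.
have -> : b' = 2^-1 * (b y * t - a y * s) by rewrite -Eb mulrA mulVf ?mul1r// pnatr_eq0.
by apply/andP; split; apply/eqP; ring.
Qed.

End HolomorphicTopForm.

(** * From charts to the manifold *)

Section Global.
Variables (R : realType) (n : nat) (M : topologicalType) (A : complex_atlas R n M).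
Local Notation d := (n + n)%N.
Local Notation J := (@stdJ R n).
Variable g : mx_field A.
Hypothesis gk : kahler g.
Implicit Types (a b : idx A) (y : 'cV[R]_d).

Let gh : hermitian_metric g := gk.1.

Lemma chart_open a : open (img a).
Proof. exact: (@img_open _ _ _ A a). Qed.

Lemma chart_pos a y : img a y -> forall v : 'cV[R]_d, v != 0 -> 0 < bilf (g a y) v v.
Proof. exact: (metric_pos gh). Qed.

Lemma chart_closed a y : img a y -> forall u v w : 'cV[R]_d,
    'D_u (fun z => ((J *m v)^T *m g a z *m w) 0 0) y
    + 'D_v (fun z => ((J *m w)^T *m g a z *m u) 0 0) y
    + 'D_w (fun z => ((J *m u)^T *m g a z *m v) 0 0) y = 0.
Proof. exact: gk.2. Qed.

Lemma form_k0_at k (phi : form_field A k) a y : form_k0 phi -> img a y ->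
  form_at (phi a y).
Proof.
move=> fk ay; split; first exact: (form_linear fk ay).
  exact: (form_alt fk ay).
exact: (form_type fk ay).
Qed.

Lemma chart_conn_sym a y u v : img a y ->
  conn (g a) y u *m v = conn (g a) y v *m u.
Proof.
move=> ay; apply: (conn_sym (D := img a)) => //; [exact: chart_open|
  exact: metric_smooth|exact: Defs.metric_sym|exact: chart_pos].
Qed.

Lemma chart_conn_J a y w : img a y -> conn (g a) y w *m J = J *m conn (g a) y w.
Proof.
move=> ay; apply: (conn_J (D := img a)) => //; [exact: chart_open|
  exact: metric_smooth|exact: Defs.metric_sym|exact: chart_pos|
  exact: metric_hermitian|exact: chart_closed].
Qed.

Lemma dtrans_J a b p : dom a p -> dom b p ->
  @dtrans _ _ _ A a b p *m J = J *m dtrans a b p.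
Proof.
move=> ap bp; apply: (transition_holomorphic a b).2.
by exists p.
Qed.

Lemma parallel_complex_structure (I : mx_field A) :
  (forall a, smooth_on (img a) (I a)) ->
  (forall a b p, dom a p -> dom b p ->
    dtrans a b p *m I a (chart a p) = I b (chart b p) *m dtrans a b p) ->
  (forall a y, img a y -> I a y *m I a y = - 1%:M) ->
  parallel_endo g I -> complex_structure I.
Proof.
move=> sI tI qI pI; split=> // a y ay.
apply: (@parallel_integrable _ _ (conn (g a) y)); last exact: qI.
  by move=> u v; exact: chart_conn_sym.
by move=> w; exact: pI.
Qed.

Section TwoForms.
Variable phi : form_field A 2.
Hypothesis phol : holomorphic_form phi.
Hypothesis cross : forall a y, img a y -> forall e : 'I_1 -> 'cV[R[i]]_d,
  orthonormal (g a y) e ->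
  conorm (g a y) (fun k => phi a y (rcons_vec e (cplx_mx (basis_vec R k)))) = 2.

Let X : mx_field A := fun a y => sharp_field (g a) (phi a) y.
Let fP a y (ay : img a y) : form_at (phi a y) := form_k0_at phol.1 ay.

Let unitg a y (ay : img a y) : g a y \in unitmx.
Proof. by apply: posdef_unitmx; exact: chart_pos. Qed.

Let X_smooth a : smooth_on (img a) (X a).
Proof.
apply: (sharp_field_smooth (D := img a)); [
  exact: chart_open|exact: metric_smooth|exact: chart_pos|].
exact: (form_smooth phol.1).
Qed.

Let X_sqr a y : img a y -> X a y *m X a y = - 1%:M.
Proof.
move=> ay; apply: (sharp_field_sqr (D := img a)) => //; [
  exact: Defs.metric_sym|exact: chart_pos|exact: metric_hermitian|exact: fP|].
exact: cross.
Qed.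

Let X_J a y : img a y -> X a y *m J = - (J *m X a y).
Proof.
move=> ay; apply: (sharp_field_J (D := img a)) => //; [
  exact: chart_pos|exact: metric_hermitian|exact: fP].
Qed.

Let X_herm a y : img a y -> (X a y)^T *m g a y *m X a y = g a y.
Proof.
move=> ay; apply: (sharp_field_herm (D := img a)) => //; [
  exact: Defs.metric_sym|exact: chart_pos|exact: metric_hermitian|exact: fP|].
exact: cross.
Qed.

Let X_parallel : parallel_endo g X.
Proof.
move=> a y ay w; apply: (sharp_field_parallel (D := img a)) => //; [
  exact: chart_open|exact: metric_smooth|
  exact: Defs.metric_sym|exact: chart_pos|exact: metric_hermitian|exact: chart_closed|
  exact: fP|exact: (form_smooth phol.1)|exact: phol.2|exact: cross].
Qed.

Lemma Phi_trans a b p : dom a p -> dom b p ->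
  re_form_mx (phi a (chart a p))
  = (dtrans a b p)^T *m re_form_mx (phi b (chart b p)) *m dtrans a b p.
Proof.
move=> ap bp; have ay : img a (chart a p) by exists p.
have bY : img b (chart b p) by exists p.
apply: bilf_ext => u v; rewrite -bilfMr -bilfMl -(Re_pairing (fP ay)) -(Re_pairing (fP bY)).
rewrite /pairing (form_trans phol.1 ap bp); congr (complex.Re (phi _ _ _)).
apply/funext => k; case: (unliftP ord_max k) => [i ->|->].
  by rewrite !rcons_vec_lift cplx_mxM.
by rewrite !rcons_vec_max cplx_mxM.
Qed.

(** The metric and the real part of the form are both pulled back by the
    differential of the coordinate change, so X is conjugated by it. *)
Let X_trans a b p : dom a p -> dom b p ->
  dtrans a b p *m X a (chart a p) = X b (chart b p) *m dtrans a b p.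
Proof.
move=> ap bp; have ay : img a (chart a p) by exists p.
have bY : img b (chart b p) by exists p.
have gt := metric_trans gh ap bp; set T := dtrans a b p in gt *.
have uT : T^T \in unitmx.
  by have := unitg ay; rewrite gt !unitmx_mul => /andP[/andP[]].
have E : T^T *m (g b (chart b p) *m (T *m X a (chart a p)))
    = T^T *m (g b (chart b p) *m (X b (chart b p) *m T)).
  rewrite !mulmxA -gt /X /sharp_field mul_sharp; last exact: chart_pos.
  rewrite -mulmxA -[T^T *m _ *m _]mulmxA [g b _ *m _]mulmxA mul_sharp; last exact: chart_pos.
  by rewrite (Phi_trans ap bp) mulNmx mulmxN !mulmxA.
have := congr1 (fun N => invmx (g b (chart b p)) *m (invmx T^T *m N)) E.
by rewrite !mulKmx// unitg.
Qed.

(** The triple is J, X and J X. *)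
Lemma two_form_hyperkahler : (exists a y, img a y) -> hyperkahler g.
Proof.
move=> [a0 [y0 ay0]].
have even_n : ~~ odd n.
  apply: (sharp_field_even (D := img a0) (G := g a0) (phi := phi a0) _ _ _ _ _ ay0); [
    exact: Defs.metric_sym|exact: chart_pos|exact: metric_hermitian|exact: fP|].
  exact: cross.
have dX a y (ay : img a y) : differentiable (X a) y by exact: (X_smooth [::]).
have K_sqr a y : img a y -> J *m X a y *m (J *m X a y) = - 1%:M.
  move=> ay; transitivity (J *m (X a y *m J) *m X a y); first by rewrite !mulmxA.
  by move: (X a y) (X_J ay) (X_sqr ay) => Y -> YY; rewrite mulmxN stdJK opprK.
have I_par : parallel_endo g (fun _ _ => J).
  by move=> a y ay w; rewrite derive_cst add0r chart_conn_J// subrr.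
have K_par : parallel_endo g (fun a y => J *m X a y).
  move=> a y ay w; rewrite /= derive_constmx; last exact: dX.
  have := X_parallel ay w; move: ('D_w (X a) y) (X a y) => DY Y P.
  by rewrite mulmxA chart_conn_J// -!mulmxA -mulmxDr -mulmxBr P mulmx0.
split.
  by exists n./2; rewrite addnn -{1}(even_halfK even_n) -!mul2n mulnA.
exists (fun _ _ => J), X, (fun a y => J *m X a y); split.
- split.
  + apply: parallel_complex_structure => // [a|a b p ap bp|a y _].
    * exact: (smooth_cst (@chart_open a)).
    * exact: dtrans_J.
    * exact: stdJ_sqr.
  + exact: parallel_complex_structure.
  + apply: parallel_complex_structure => // [a|a b p ap bp].
      apply: smooth_mulmx => //; [exact: chart_open|exact: (smooth_cst (@chart_open a))].
    by rewrite mulmxA dtrans_J// -!mulmxA X_trans.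
- split=> [a y ay|a y ay|a y ay].
  + exact: (metric_hermitian gh).
  + exact: X_herm.
  + transitivity ((X a y)^T *m (J^T *m g a y *m J) *m X a y).
      by rewrite trmx_mul !mulmxA.
    by rewrite (metric_hermitian gh ay) X_herm.
- by split.
- by move=> a y ay; exact: K_sqr.
Qed.

End TwoForms.
End Global.

Lemma empty_calabi_yau (R : realType) n (M : topologicalType)
    (A : complex_atlas R n M) (g : mx_field A) :
  kahler g -> (forall (a : idx A) y, ~ img a y) -> calabi_yau g.
Proof.
move=> gk no; split=> //; exists (fun _ _ _ => 0).
split; [split; first split|by move=> a y /no|by move=> a y /no].
- by move=> a y /no.
- by move=> a y /no.
- by move=> a y /no.
- by move=> a v; split=> s y /no.
- by [].
- by move=> a y /no.
Qed.

Lemma top_form_calabi_yau (R : realType) r (M : topologicalType)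
    (A : complex_atlas R r.+1 M) (g : mx_field A) (phi : form_field A r.+1) :
  kahler g -> cvcp g phi -> calabi_yau g.
Proof.
move=> gk [phol cross]; split=> //; exists phi.
have gh := gk.1; pose c : R := (2 `^ (r.+1%:R / 2)) ^+ 2.
have c0 : 0 < c by rewrite exprn_gt0// powR_gt0.
have cross' (a : idx A) y : img a y -> forall e, orthonormal (g a y) e ->
  conorm (g a y) (fun k => phi a y (rcons_vec e (cplx_mx (basis_vec R k)))) ^+ 2 = c.
  by move=> ay e [Te He]; rewrite (cross _ _ ay).
split=> //.
  move=> a y ay; exists (@std_frame R r.+1).
  have [q0 _] := top_norm (Defs.metric_sym gh ay) (chart_pos gk ay) (metric_hermitian gh ay)
    (form_k0_at phol.1 ay) c0 (cross' a y ay).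
  by apply: contraTneq q0 => ->; rewrite /sq_norm /= expr0n addr0 ltxx.
move=> a y ay w v.
apply: (top_parallel (D := img a) _ _ _ _ _ _ _ _ _ c0 (cross' a) ay); [
  exact: chart_open|exact: metric_smooth|
  exact: Defs.metric_sym|exact: chart_pos|exact: metric_hermitian|exact: chart_closed|
  by move=> y' ay'; exact: form_k0_at phol.1 ay'|exact: (form_smooth phol.1)|exact: phol.2].
Qed.

Theorem theorem1 (R : realType) (n r : nat) (M : topologicalType)
  (A : complex_atlas R n M) (g : mx_field A) (phi : form_field A r.+1)
  (M_hausdorff : hausdorff_space M) (M_compact : compact [set: M])
  (g_kahler : kahler g)
  (r_ge1 : (1 <= r)%N) (r_le_n : (r <= n)%N)
  (phi_cvcp : cvcp g phi) :
  calabi_yau g \/ hyperkahler g.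
Proof.
have [ex|nex] := pselect (exists (a : idx A) y, img a y); last first.
  by left; apply: empty_calabi_yau => // a y ay; apply: nex; exists a, y.
have gh := g_kahler.1; have [phol cross] := phi_cvcp.
have [nr|nr] := eqVneq n r.+1.
  by subst n; left; exact: top_form_calabi_yau phi_cvcp.
(* The remaining degrees are settled at a single point. *)
have [a [y ay]] := ex; have fP := form_k0_at phol.1 ay.
have symG := Defs.metric_sym gh ay; have posG := chart_pos g_kahler ay.
have hermG := metric_hermitian gh ay.
have [e [Te He]] := unitary_frame symG posG (leqnn n).
have Eo : orthonormal (g a y) (fun i : 'I_n => e i).
  by split=> [i|i j]; [exact: Te | rewrite He].
pose c : R := (2 `^ (r.+1%:R / 2)) ^+ 2.
have c0 : 0 < c by rewrite exprn_gt0// powR_gt0.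
have cross' e' : orthonormal (g a y) e' ->
  conorm (g a y) (fun k => phi a y (rcons_vec e' (cplx_mx (basis_vec R k)))) ^+ 2 = c.
  by move=> [Te' He']; rewrite (cross _ _ ay).
have rn : r != n := cross_degree_neq posG hermG fP cross' Eo (lt0r_neq0 c0) r_le_n.
have rn2 : (r.+2 <= n)%N by rewrite ltn_neqAle eq_sym nr ltn_neqAle rn.
case: r => [//|[|q]] in phi r_ge1 r_le_n phi_cvcp phol cross nr fP c c0 cross' rn rn2 *.
  right; apply: (two_form_hyperkahler g_kahler phol) ex => a' y' ay' e' [Te' He'].
  by rewrite (cross _ _ ay')// divff ?powRr1.
by have := no_cross_product symG posG hermG fP c0 cross' Eo rn2.
Qed.
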